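(* There exists a maximal cofinitary group $G \le S_\infty$ which is arithmetical: there is $n\in\mathbb N$ such that $G$, viewed as a subset of Baire space ${}^{\mathbb N}\mathbb N$, is definable by a parameter-free $\Sigma^0_n$ formula of second-order arithmetic (a formula whose only quantifiers range over natural numbers). In particular $G$ is a Borel set of finite Borel rank.
   Context: $S_\infty$ denotes the group of all bijections $\mathbb N\to\mathbb N$, regarded as a subset of Baire space ${}^{\mathbb N}\mathbb N$. A subgroup $G\le S_\infty$ is cofinitary if every non-identity element of $G$ has only finitely many fixed points. A cofinitary group is maximal cofinitary if it is not a proper subgroup of any cofinitary subgroup of $S_\infty$. *)

(* Defs.v *)
From Stdlib Require Import Arith List.

Definition baire := nat -> nat.

Definition is_bijection (f : baire) : Prop :=
  (forall x y, f x = f y -> x = y) /\ (forall y, exists x, f x = y).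

Definition is_inverse (f g : baire) : Prop :=
  (forall x, g (f x) = x) /\ (forall x, f (g x) = x).

Definition subgroup_Sinf (G : baire -> Prop) : Prop :=
  (forall f, G f -> is_bijection f) /\
  G (fun n => n) /\
  (forall f g, G f -> G g -> G (fun n => f (g n))) /\
  (forall f g, G f -> is_inverse f g -> G g).

Definition finitely_many_fixed_points (f : baire) : Prop :=
  exists N, forall n, f n = n -> n < N.

Definition cofinitary (G : baire -> Prop) : Prop :=
  subgroup_Sinf G /\
  forall f, G f -> (exists n, f n <> n) -> finitely_many_fixed_points f.

Definition maximal_cofinitary (G : baire -> Prop) : Prop :=
  cofinitary G /\
  forall H : baire -> Prop,
    cofinitary H -> (forall f, G f -> H f) -> forall f, H f -> G f.

(* Terms of first-order arithmetic with one unary function symbol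
   [tf] interpreted by the real (function) variable; number variables
   are de Bruijn indices. *)
Inductive term : Type :=
| tvar : nat -> term
| tzero : term
| tsucc : term -> term
| tadd : term -> term -> term
| tmul : term -> term -> term
| tf : term -> term.

Inductive formula : Type :=
| feq : term -> term -> formula
| flt : term -> term -> formula
| fnot : formula -> formula
| fand : formula -> formula -> formula
| for_ : formula -> formula -> formula
| fex : formula -> formula
| fall : formula -> formula.

Fixpoint eval_term (x : baire) (env : nat -> nat) (t : term) : nat :=
  match t with
  | tvar i => env i
  | tzero => 0
  | tsucc t => S (eval_term x env t)
  | tadd t u => eval_term x env t + eval_term x env u
  | tmul t u => eval_term x env t * eval_term x env u
  | tf t => x (eval_term x env t)
  end.

Definition scons (a : nat) (env : nat -> nat) : nat -> nat :=
  fun i => match i with 0 => a | S j => env j end.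

Fixpoint sat (x : baire) (env : nat -> nat) (p : formula) : Prop :=
  match p with
  | feq t u => eval_term x env t = eval_term x env u
  | flt t u => eval_term x env t < eval_term x env u
  | fnot p => ~ sat x env p
  | fand p q => sat x env p /\ sat x env q
  | for_ p q => sat x env p \/ sat x env q
  | fex p => exists a, sat x (scons a env) p
  | fall p => forall a, sat x (scons a env) p
  end.

Fixpoint term_closed (k : nat) (t : term) : Prop :=
  match t with
  | tvar i => i < k
  | tzero => True
  | tsucc t | tf t => term_closed k t
  | tadd t u | tmul t u => term_closed k t /\ term_closed k u
  end.

Fixpoint closed_below (k : nat) (p : formula) : Prop :=
  match p with
  | feq t u | flt t u => term_closed k t /\ term_closed k u
  | fnot p => closed_below k p
  | fand p q | for_ p q => closed_below k p /\ closed_below k q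
  | fex p | fall p => closed_below (S k) p
  end.

Fixpoint quantifier_free (p : formula) : Prop :=
  match p with
  | feq _ _ | flt _ _ => True
  | fnot p => quantifier_free p
  | fand p q | for_ p q => quantifier_free p /\ quantifier_free q
  | fex _ | fall _ => False
  end.

Inductive is_Sigma : nat -> formula -> Prop :=
| Sigma0 p : quantifier_free p -> is_Sigma 0 p
| SigmaPi n p : is_Pi n p -> is_Sigma (S n) p
| SigmaEx n p : is_Sigma (S n) p -> is_Sigma (S n) (fex p)
with is_Pi : nat -> formula -> Prop :=
| Pi0 p : quantifier_free p -> is_Pi 0 p
| PiSigma n p : is_Sigma n p -> is_Pi (S n) p
| PiAll n p : is_Pi (S n) p -> is_Pi (S n) (fall p).

Definition Sigma0n_definable (n : nat) (G : baire -> Prop) : Prop :=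
  exists p : formula,
    is_Sigma n p /\ closed_below 0 p /\
    forall x : baire, G x <-> sat x (fun _ => 0) p.

Definition arithmetical (G : baire -> Prop) : Prop :=
  exists n, Sigma0n_definable n G.

(* Main.v *)
From Stdlib Require Import Arith List Lia Classical ClassicalEpsilon FunctionalExtensionality.
From Stdlib Require Import Wf_nat Factorial FinFun.
Require Import Defs.
Import ListNotations.

(** The set [nat] is split into finite levels.  Level [n] carries an involution for every binary word
    of length [n], such that no short reduced product of these has a fixed point there.  A binary
    sequence [x] acts on level [n] through its restriction to [n]; since distinct sequences eventually
    have distinct restrictions, these involutions [ee x] generate a cofinitary group, a free product of
    groups of order two.

    To make it maximal, let [h] be the permutation coded by [x].  On infinitely many levels one
    replaces the edges [m -- ee x m] and [h m -- ee x (h m)] of the matching [ee x] by [m -- h m] and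
    [ee x m -- ee x (h m)], so that the new involution [dot x] agrees with [h] at infinitely many [m].
    This creates no short cycle provided that no fixed word in the [ee y] joins [m] to [h m] on
    infinitely many of these levels.  If the levels cannot be chosen so, then almost every level at
    which [x] could be modified extends coherently to infinitely many others; a coherent chain of words
    defines finitely many sequences, and the product of the corresponding generators agrees with [h]
    infinitely often.  The choice between the two cases is arithmetical, because it only asks which
    levels have infinitely many coherent extensions.

    Finally, an element of the group agrees on level [n], with at most [n] exceptions, with a unique
    short word, from which its generators can be read off. *)

(** Infinite agreement is all that maximality needs: if a cofinitary group contains this one and
    also [h], and [h] agrees infinitely often with an element [g] of this group, then the inverse of
    [g] composed with [h] has infinitely many fixed points, so [h = g].

    The obstacle is that no generator may be built by looking at the others: whether and where it is
    modified must be decided arithmetically from its own index [x]. Therefore each [x] owns an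
    infinite set of levels, almost disjoint from that of any other sequence, and the words that must
    not join [m] to [h m] are words in the unmodified [ee y]. Level [n] tests only words of length
    at most [n] over binary words of length [n]; every fixed reduced word of sequences eventually
    becomes one of these. Every binary [x] yields a generator, whether or not it codes a
    permutation, and cofinitariness holds for all of them.

    Membership in the group asks for finitely many reals, hence is analytic as it stands. Reading
    the generators off from the element replaces these quantifiers by one over the length of the
    word. *)

(** * Least witnesses and case distinction *)

Definition mu (P : nat -> Prop) : nat :=
  epsilon (inhabits 0) (fun n => (P n /\ forall m, P m -> n <= m) \/ (~ (exists k, P k) /\ n = 0)).

Definition ite {T : Type} (P : Prop) (a b : T) : T :=
  if excluded_middle_informative P then a else b.

Lemma least_exists (P : nat -> Prop) (k : nat) :
  P k -> exists n, P n /\ forall m, P m -> n <= m.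
Proof.
  induction k as [k IH] using (well_founded_induction lt_wf). intros Hk.
  destruct (classic (exists j, P j /\ j < k)) as [[j [Hj Hlt]]|Hn].
  - exact (IH j Hlt Hj).
  - exists k. split; [exact Hk|]. intros m Hm.
    destruct (le_lt_dec k m) as [|Hlt]; [assumption|]. exfalso. eauto.
Qed.

Lemma mu_spec (P : nat -> Prop) :
  (P (mu P) /\ forall m, P m -> mu P <= m) \/ (~ (exists k, P k) /\ mu P = 0).
Proof.
  unfold mu. apply epsilon_spec.
  destruct (classic (exists k, P k)) as [[k Hk]|Hn].
  - destruct (least_exists P k Hk) as [n Hn]. exists n. now left.
  - exists 0. now right.
Qed.

Lemma mu_in (P : nat -> Prop) (k : nat) : P k -> P (mu P).
Proof.
  intros Hk. destruct (mu_spec P) as [[H _]|[H _]]; [exact H|]. exfalso. eauto.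
Qed.

Lemma mu_le (P : nat -> Prop) (k : nat) : P k -> mu P <= k.
Proof.
  intros Hk. destruct (mu_spec P) as [[_ H]|[H _]]; [auto|]. exfalso. eauto.
Qed.

Lemma mu_eq (P : nat -> Prop) (k : nat) : P k -> (forall m, P m -> m = k) -> mu P = k.
Proof. intros Hk Hu. apply Hu. now apply mu_in with k. Qed.

Lemma ite_true {T : Type} (P : Prop) (a b : T) : P -> ite P a b = a.
Proof. unfold ite. now destruct (excluded_middle_informative P). Qed.

Lemma ite_false {T : Type} (P : Prop) (a b : T) : ~ P -> ite P a b = b.
Proof. unfold ite. now destruct (excluded_middle_informative P). Qed.

(** * Arithmetical predicates and functions *)

Definition env := nat -> nat.

(** One formula serves all [x] and all environments. It may have free variables; they are quantified
    away only in [dp_arithmetical]. *)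
Definition dp (P : baire -> env -> Prop) : Prop :=
  exists p, forall x e, P x e <-> sat x e p.

(* In a graph, variable 0 is the value, and the arguments are shifted by one. *)
Definition df (F : baire -> env -> nat) : Prop :=
  dp (fun x e => e 0 = F x (fun i => e (S i))).

Definition dfun (H : baire -> env -> baire) : Prop :=
  df (fun x e => H x (fun i => e (S i)) (e 0)).

Lemma dp_iff (P Q : baire -> env -> Prop) :
  (forall x e, Q x e <-> P x e) -> dp P -> dp Q.
Proof. intros H [p Hp]. exists p. intros x e. rewrite H. apply Hp. Qed.

Lemma df_eqfun (F G : baire -> env -> nat) :
  (forall x e, G x e = F x e) -> df F -> df G.
Proof. intros H. apply dp_iff. intros x e. now rewrite H. Qed.

Lemma dp_and (P Q : baire -> env -> Prop) : dp P -> dp Q -> dp (fun x e => P x e /\ Q x e).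
Proof.
  intros [p Hp] [q Hq]. exists (fand p q). intros x e. simpl. now rewrite Hp, Hq.
Qed.

Lemma dp_or (P Q : baire -> env -> Prop) : dp P -> dp Q -> dp (fun x e => P x e \/ Q x e).
Proof.
  intros [p Hp] [q Hq]. exists (for_ p q). intros x e. simpl. now rewrite Hp, Hq.
Qed.

Lemma dp_not (P : baire -> env -> Prop) : dp P -> dp (fun x e => ~ P x e).
Proof. intros [p Hp]. exists (fnot p). intros x e. simpl. now rewrite Hp. Qed.

Lemma dp_imp (P Q : baire -> env -> Prop) : dp P -> dp Q -> dp (fun x e => P x e -> Q x e).
Proof.
  intros HP HQ. apply (dp_iff (fun x e => ~ P x e \/ Q x e)).
  - intros x e. split; [apply imply_to_or | tauto].
  - auto using dp_or, dp_not.
Qed.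

Lemma dp_ex (R : baire -> env -> nat -> Prop) :
  dp (fun x e => R x (fun i => e (S i)) (e 0)) -> dp (fun x e => exists a, R x e a).
Proof.
  intros [p Hp]. exists (fex p). intros x e. simpl.
  split; intros [a Ha]; exists a; apply (Hp x (scons a e)); exact Ha.
Qed.

Lemma dp_all (R : baire -> env -> nat -> Prop) :
  dp (fun x e => R x (fun i => e (S i)) (e 0)) -> dp (fun x e => forall a, R x e a).
Proof.
  intros [p Hp]. exists (fall p). intros x e. simpl.
  split; intros H a; apply (Hp x (scons a e)); apply H.
Qed.

(** * Renaming of variables and closure properties *)

Fixpoint tren (r : nat -> nat) (t : term) : term :=
  match t with
  | tvar i => tvar (r i)
  | tzero => tzero
  | tsucc t => tsucc (tren r t)
  | tadd t u => tadd (tren r t) (tren r u)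
  | tmul t u => tmul (tren r t) (tren r u)
  | tf t => tf (tren r t)
  end.

Definition upren (r : nat -> nat) : nat -> nat := scons 0 (fun i => S (r i)).

Fixpoint fren (r : nat -> nat) (p : formula) : formula :=
  match p with
  | feq t u => feq (tren r t) (tren r u)
  | flt t u => flt (tren r t) (tren r u)
  | fnot p => fnot (fren r p)
  | fand p q => fand (fren r p) (fren r q)
  | for_ p q => for_ (fren r p) (fren r q)
  | fex p => fex (fren (upren r) p)
  | fall p => fall (fren (upren r) p)
  end.

Lemma eval_tren (x : baire) (r : nat -> nat) (t : term) (e e' : env) :
  (forall i, e' i = e (r i)) -> eval_term x e (tren r t) = eval_term x e' t.
Proof. intros H. induction t; simpl; congruence. Qed.

Lemma sat_fren (x : baire) (p : formula) : forall (r : nat -> nat) (e e' : env),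
  (forall i, e' i = e (r i)) -> sat x e (fren r p) <-> sat x e' p.
Proof.
  assert (Hup : forall (r : nat -> nat) (e e' : env) (a : nat), (forall i, e' i = e (r i)) ->
            forall i, scons a e' i = scons a e (upren r i)).
  { intros r e e' a H [|i]; simpl; auto. }
  induction p; intros r e e' H; simpl.
  - now rewrite !(eval_tren x r _ e e' H).
  - now rewrite !(eval_tren x r _ e e' H).
  - now rewrite (IHp r e e' H).
  - now rewrite (IHp1 r e e' H), (IHp2 r e e' H).
  - now rewrite (IHp1 r e e' H), (IHp2 r e e' H).
  - split; intros [a Ha]; exists a; apply (IHp (upren r) (scons a e) (scons a e')); auto.
  - split; intros Ha a; apply (IHp (upren r) (scons a e) (scons a e')); auto.
Qed.

Lemma dp_ren (P : baire -> env -> Prop) (r : nat -> nat) :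
  dp P -> dp (fun x e => P x (fun i => e (r i))).
Proof.
  intros [p Hp]. exists (fren r p). intros x e. rewrite Hp. symmetry. now apply sat_fren.
Qed.

Lemma df_ren (F : baire -> env -> nat) (r : nat -> nat) :
  df F -> df (fun x e => F x (fun i => e (r i))).
Proof. intros H. exact (dp_ren _ (upren r) H). Qed.

Lemma dp_subst (P : baire -> env -> nat -> Prop) (F : baire -> env -> nat) :
  dp (fun x e => P x (fun i => e (S i)) (e 0)) -> df F -> dp (fun x e => P x e (F x e)).
Proof.
  intros HP HF. apply (dp_iff (fun x e => exists a, a = F x e /\ P x e a)).
  - intros x e. split; [eauto | intros [a [-> H]]; exact H].
  - apply dp_ex. apply dp_and; assumption.
Qed.

Lemma df_var (i : nat) : df (fun x e => e i).
Proof. exists (feq (tvar 0) (tvar (S i))). reflexivity. Qed.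

Lemma dp_eq (F G : baire -> env -> nat) : df F -> df G -> dp (fun x e => F x e = G x e).
Proof. intros HF HG. exact (dp_subst (fun x e a => a = G x e) F HG HF). Qed.

Lemma df_subst (F : baire -> env -> nat -> nat) (A : baire -> env -> nat) :
  df (fun x e => F x (fun i => e (S i)) (e 0)) -> df A -> df (fun x e => F x e (A x e)).
Proof.
  intros HF HA. apply (dp_subst (fun x e a => e 0 = F x (fun i => e (S i)) a)).
  - exact (dp_ren _ (fun i => match i with 0 => 1 | 1 => 0 | S (S k) => S (S k) end) HF).
  - exact (df_ren A S HA).
Qed.

Lemma dp_lt (F G : baire -> env -> nat) : df F -> df G -> dp (fun x e => F x e < G x e).
Proof.
  intros HF HG. apply (dp_subst (fun x e a => a < G x e)); [|exact HF].
  apply (dp_subst (fun x e a => e 0 < a)); [|exact (df_ren G S HG)].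
  exists (flt (tvar 1) (tvar 0)). reflexivity.
Qed.

Lemma dp_le (F G : baire -> env -> nat) : df F -> df G -> dp (fun x e => F x e <= G x e).
Proof.
  intros HF HG. apply (dp_iff (fun x e => ~ (G x e < F x e))).
  - intros x e. lia.
  - auto using dp_not, dp_lt.
Qed.

Lemma df_const (n : nat) : df (fun x e => n).
Proof.
  exists (feq (tvar 0) (Nat.iter n tsucc tzero)). intros x e. simpl.
  assert (H : eval_term x e (Nat.iter n tsucc tzero) = n) by (induction n; simpl; congruence).
  now rewrite H.
Qed.

Lemma df_S (F : baire -> env -> nat) : df F -> df (fun x e => S (F x e)).
Proof.
  apply (df_subst (fun x e a => S a)). exists (feq (tvar 0) (tsucc (tvar 1))). reflexivity.
Qed.

Lemma df_tf (F : baire -> env -> nat) : df F -> df (fun x e => x (F x e)).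
Proof.
  apply (df_subst (fun x e a => x a)). exists (feq (tvar 0) (tf (tvar 1))). reflexivity.
Qed.

Lemma df_add (F G : baire -> env -> nat) : df F -> df G -> df (fun x e => F x e + G x e).
Proof.
  intros HF HG. apply (df_subst (fun x e a => a + G x e)); [|exact HF].
  apply (df_subst (fun x e a => e 0 + a)); [|exact (df_ren G S HG)].
  exists (feq (tvar 0) (tadd (tvar 2) (tvar 1))). reflexivity.
Qed.

Lemma df_mul (F G : baire -> env -> nat) : df F -> df G -> df (fun x e => F x e * G x e).
Proof.
  intros HF HG. apply (df_subst (fun x e a => a * G x e)); [|exact HF].
  apply (df_subst (fun x e a => e 0 * a)); [|exact (df_ren G S HG)].
  exists (feq (tvar 0) (tmul (tvar 2) (tvar 1))). reflexivity.
Qed.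

(** * Substitution of definable functions for the function variable *)

Lemma sat_ext (x : baire) (p : formula) (e e' : env) :
  (forall i, e i = e' i) -> sat x e p -> sat x e' p.
Proof.
  intros H Hs. assert (e = e') as <- by (now apply functional_extensionality). exact Hs.
Qed.

Lemma df_eval (H : baire -> env -> baire) (T : nat -> baire -> env -> nat) (t : term) :
  dfun H -> (forall i, df (T i)) -> df (fun x e => eval_term (H x e) (fun i => T i x e) t).
Proof.
  intros HH HT. induction t; simpl; auto using df_const, df_S, df_add, df_mul.
  exact (df_subst (fun x e a => H x e a) _ HH IHt).
Qed.

(** By induction on the formula, each application of the function symbol is replaced by the graph of
    [H]. This is what allows predicates of a permutation to be applied to [decoded x], and [dot] to
    a generator read off from a group element. *)
Lemma dp_app (R : baire -> env -> Prop) (H : baire -> env -> baire) (T : nat -> baire -> env -> nat) :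
  dp R -> dfun H -> (forall i, df (T i)) -> dp (fun x e => R (H x e) (fun i => T i x e)).
Proof.
  intros [p Hp] HH HT.
  apply (dp_iff (fun x e => sat (H x e) (fun i => T i x e) p)); [intros; apply Hp|].
  clear R Hp. revert H T HH HT.
  assert (Hq : forall (p : formula), (forall (H : baire -> env -> baire) (T : nat -> baire -> env -> nat),
             dfun H -> (forall i, df (T i)) -> dp (fun x e => sat (H x e) (fun i => T i x e) p)) ->
           forall (H : baire -> env -> baire) (T : nat -> baire -> env -> nat),
             dfun H -> (forall i, df (T i)) ->
             dp (fun x e => sat (H x (fun i => e (S i))) (scons (e 0) (fun i => T i x (fun i => e (S i)))) p)).
  { intros q IH H T HH HT.
    apply (dp_iff (fun x e => sat (H x (fun i => e (S i)))
       (fun i => (match i with 0 => fun x e => e 0 | S j => fun x e => T j x (fun i => e (S i)) end) x e) q)).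
    - intros x e. split; apply sat_ext; intros [|i]; reflexivity.
    - apply (IH (fun x e => H x (fun i => e (S i)))
               (fun i => match i with 0 => fun x e => e 0 | S j => fun x e => T j x (fun i => e (S i)) end)).
      + exact (df_ren _ (upren S) HH).
      + intros [|j]; [apply df_var | exact (df_ren _ S (HT j))]. }
  induction p as [t u|t u|q IH|q1 IH1 q2 IH2|q1 IH1 q2 IH2|q IH|q IH]; intros H T HH HT; simpl.
  - apply dp_eq; now apply df_eval.
  - apply dp_lt; now apply df_eval.
  - now apply dp_not, IH.
  - apply dp_and; auto.
  - apply dp_or; auto.
  - apply (dp_ex (fun x e a => sat (H x e) (scons a (fun i => T i x e)) q)). now apply Hq.
  - apply (dp_all (fun x e a => sat (H x e) (scons a (fun i => T i x e)) q)). now apply Hq.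
Qed.

Definition tup1 (A : baire -> env -> nat) : nat -> baire -> env -> nat := fun _ => A.
Definition tcons (A : baire -> env -> nat) (T : nat -> baire -> env -> nat) :=
  fun i => match i with 0 => A | S j => T j end.

Lemma df_tcons (A : baire -> env -> nat) (T : nat -> baire -> env -> nat) :
  df A -> (forall i, df (T i)) -> forall i, df (tcons A T i).
Proof. intros HA HT [|i]; simpl; auto. Qed.

Lemma df_app (F : baire -> env -> nat) (H : baire -> env -> baire) (T : nat -> baire -> env -> nat) :
  df F -> dfun H -> (forall i, df (T i)) -> df (fun x e => F (H x e) (fun i => T i x e)).
Proof.
  intros HF HH HT.
  apply (dp_app (fun x e => e 0 = F x (fun i => e (S i))) (fun x e => H x (fun i => e (S i)))
           (tcons (fun x e => e 0) (fun i x e => T i x (fun i => e (S i))))).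
  - exact HF.
  - exact (df_ren _ (upren S) HH).
  - apply df_tcons; [apply df_var|]. intros i. exact (df_ren _ S (HT i)).
Qed.

Lemma dp_rel1 (R : baire -> nat -> Prop) (HR : dp (fun x e => R x (e 0)))
  (H : baire -> env -> baire) (A : baire -> env -> nat) :
  dfun H -> df A -> dp (fun x e => R (H x e) (A x e)).
Proof. intros HH HA. exact (dp_app _ H (tup1 A) HR HH (fun _ => HA)). Qed.

Lemma dp_rel2 (R : baire -> nat -> nat -> Prop) (HR : dp (fun x e => R x (e 0) (e 1)))
  (H : baire -> env -> baire) (A B : baire -> env -> nat) :
  dfun H -> df A -> df B -> dp (fun x e => R (H x e) (A x e) (B x e)).
Proof.
  intros HH HA HB.
  exact (dp_app _ H (tcons A (tup1 B)) HR HH (df_tcons _ _ HA (fun _ => HB))).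
Qed.

Lemma dp_rel3 (R : baire -> nat -> nat -> nat -> Prop) (HR : dp (fun x e => R x (e 0) (e 1) (e 2)))
  (H : baire -> env -> baire) (A B C : baire -> env -> nat) :
  dfun H -> df A -> df B -> df C -> dp (fun x e => R (H x e) (A x e) (B x e) (C x e)).
Proof.
  intros HH HA HB HC.
  exact (dp_app _ H (tcons A (tcons B (tup1 C))) HR HH
           (df_tcons _ _ HA (df_tcons _ _ HB (fun _ => HC)))).
Qed.

Lemma df_fun1 (F : baire -> nat -> nat) (HF : df (fun x e => F x (e 0)))
  (H : baire -> env -> baire) (A : baire -> env -> nat) :
  dfun H -> df A -> df (fun x e => F (H x e) (A x e)).
Proof. intros HH HA. exact (df_app _ H (tup1 A) HF HH (fun _ => HA)). Qed.

Lemma df_fun2 (F : baire -> nat -> nat -> nat) (HF : df (fun x e => F x (e 0) (e 1)))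
  (H : baire -> env -> baire) (A B : baire -> env -> nat) :
  dfun H -> df A -> df B -> df (fun x e => F (H x e) (A x e) (B x e)).
Proof.
  intros HH HA HB.
  exact (df_app _ H (tcons A (tup1 B)) HF HH (df_tcons _ _ HA (fun _ => HB))).
Qed.

Lemma df_fun3 (F : baire -> nat -> nat -> nat -> nat) (HF : df (fun x e => F x (e 0) (e 1) (e 2)))
  (H : baire -> env -> baire) (A B C : baire -> env -> nat) :
  dfun H -> df A -> df B -> df C -> df (fun x e => F (H x e) (A x e) (B x e) (C x e)).
Proof.
  intros HH HA HB HC.
  exact (df_app _ H (tcons A (tcons B (tup1 C))) HF HH
           (df_tcons _ _ HA (df_tcons _ _ HB (fun _ => HC)))).
Qed.

Lemma dfun_id : dfun (fun x e => x).
Proof. exact (df_tf _ (df_var 0)). Qed.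

Lemma df_mu (P : baire -> env -> nat -> Prop) :
  dp (fun x e => P x (fun i => e (S i)) (e 0)) -> df (fun x e => mu (P x e)).
Proof.
  intros HP.
  assert (HP1 : dp (fun x e => P x (fun i => e (S (S i))) (e 0)))
    by exact (dp_ren _ (fun i => match i with 0 => 0 | S j => S (S j) end) HP).
  assert (HP2 : dp (fun x e => P x (fun i => e (S (S i))) (e 1)))
    by exact (dp_ren _ (fun i => match i with 0 => 1 | S j => S (S j) end) HP).
  apply (dp_iff (fun x e => (P x (fun i => e (S i)) (e 0) /\ (forall a, P x (fun i => e (S i)) a -> e 0 <= a))
            \/ (~ (exists a, P x (fun i => e (S i)) a) /\ e 0 = 0))).
  - intros x e. set (Q := P x (fun i => e (S i))). split.
    + intros ->. exact (mu_spec Q).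
    + intros [[H1 H2]|[H1 ->]]; destruct (mu_spec Q) as [[H3 H4]|[H3 H4]]; auto.
      * apply Nat.le_antisymm; auto.
      * exfalso. eauto.
      * exfalso. eauto.
  - apply dp_or; apply dp_and.
    + exact HP.
    + apply (dp_all (fun x e a => P x (fun i => e (S i)) a -> e 0 <= a)).
      apply dp_imp; [exact HP1|]. apply dp_le; apply df_var.
    + apply dp_not. apply (dp_ex (fun x e a => P x (fun i => e (S i)) a)). exact HP1.
    + apply dp_eq; [apply df_var | apply df_const].
Qed.

Lemma df_ite (P : baire -> env -> Prop) (F G : baire -> env -> nat) :
  dp P -> df F -> df G -> df (fun x e => ite (P x e) (F x e) (G x e)).
Proof.
  intros HP HF HG.
  apply (dp_iff (fun x e => (P x (fun i => e (S i)) /\ e 0 = F x (fun i => e (S i))) \/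
                      (~ P x (fun i => e (S i)) /\ e 0 = G x (fun i => e (S i))))).
  - intros x e. destruct (classic (P x (fun i => e (S i)))) as [H|H].
    + rewrite ite_true by exact H. tauto.
    + rewrite ite_false by exact H. tauto.
  - assert (H' := dp_ren P S HP). auto using dp_or, dp_and, dp_not.
Qed.

(** * Pairing, the beta function and primitive recursion *)

(** Injective because [a] is smaller than the gap between the squares of [a + b] and [a + b + 1]. It
    is not onto; on other numbers [mu] makes both projections 0. *)
Definition cpair (a b : nat) : nat := (a + b) * (a + b) + a.
Definition cfst (c : nat) : nat := mu (fun a => exists b, c = cpair a b).
Definition csnd (c : nat) : nat := mu (fun b => exists a, c = cpair a b).

Lemma cpair_inj (a b a' b' : nat) : cpair a b = cpair a' b' -> a = a' /\ b = b'.
Proof.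
  unfold cpair. intros H.
  assert (a + b = a' + b'); [|nia].
  destruct (lt_eq_lt_dec (a + b) (a' + b')) as [[Hl|He]|Hl]; [exfalso|exact He|exfalso]; nia.
Qed.

Lemma cfst_pair (a b : nat) : cfst (cpair a b) = a.
Proof.
  apply mu_eq; [now exists b|]. intros m [b' H]. apply cpair_inj in H. symmetry; tauto.
Qed.

Lemma csnd_pair (a b : nat) : csnd (cpair a b) = b.
Proof.
  apply mu_eq; [now exists a|]. intros m [a' H]. apply cpair_inj in H. symmetry; tauto.
Qed.

(* Goedel's beta function. *)
Definition beta (c i : nat) : nat := cfst c mod S (S i * csnd c).

(** A common divisor [d] is prime to [b = m!], since it divides [1 + (i + 1) b]. It divides the
    difference [b (j - i)] of the moduli, hence [j - i], hence [b]; so [d] is 1. *)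
Lemma beta_moduli_coprime (m i j : nat) :
  i < j -> j <= m -> Nat.gcd (S (S i * fact m)) (S (S j * fact m)) = 1.
Proof.
  intros Hij Hjm. set (b := fact m). set (d := Nat.gcd _ _).
  assert (D1 : Nat.divide d (S (S i * b))) by apply Nat.gcd_divide_l.
  assert (D2 : Nat.divide d (S (S j * b))) by apply Nat.gcd_divide_r.
  assert (Hcop : Nat.gcd d b = 1).
  { apply Nat.divide_1_r. apply (Nat.divide_add_cancel_r _ (S i * b)).
    - apply Nat.divide_mul_r, Nat.gcd_divide_r.
    - replace (S i * b + 1) with (S (S i * b)) by lia.
      eapply Nat.divide_trans; [apply Nat.gcd_divide_l | exact D1]. }
  assert (D3 : Nat.divide d (b * (j - i))).
  { apply (Nat.divide_add_cancel_r _ (S (S i * b))); [exact D1|].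
    replace (S (S i * b) + b * (j - i)) with (S (S j * b)) by nia. exact D2. }
  apply Nat.gauss in D3; [|exact Hcop].
  assert (D4 : Nat.divide (j - i) b).
  { unfold b. clear -Hij Hjm. assert (H : 0 < j - i <= m) by lia. clear Hij Hjm. revert H.
    generalize (j - i) as k. intros k. induction m as [|m IH]; [lia|]. intros H. simpl fact.
    destruct (Nat.eq_dec k (S m)) as [->|Hne].
    - exists (fact m). ring.
    - replace (fact m + m * fact m) with (S m * fact m) by lia.
      apply Nat.divide_mul_r, IH. lia. }
  apply Nat.divide_1_r. rewrite <- Hcop. apply Nat.gcd_greatest; [apply Nat.divide_refl|].
  eapply Nat.divide_trans; eassumption.
Qed.

Lemma crt (m f : nat -> nat) (n : nat) :
  (forall i j, i < j -> j < n -> Nat.gcd (m i) (m j) = 1) -> (forall i, i < n -> f i < m i) ->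
  exists a, forall i, i < n -> a mod m i = f i.
Proof.
  intros Hc Hf.
  (* The invariant carries a common multiple [p] of the moduli treated so far that is coprime to all
     later ones; adding multiples of [p] preserves the residues already achieved. *)
  assert (H : forall k, k <= n -> exists a p, (forall i, i < k -> a mod m i = f i) /\
             (forall i, i < k -> Nat.divide (m i) p) /\
             (forall j, k <= j -> j < n -> Nat.gcd (m j) p = 1)).
  { induction k as [|k IH]; intros Hk.
    - exists 0, 1. repeat split; try lia. intros. apply Nat.divide_1_r, Nat.gcd_divide_r.
    - destruct IH as (a & p & H1 & H2 & H3); [lia|].
      assert (Hm : m k <> 0) by (specialize (Hf k); lia).
      destruct (Nat.gcd_bezout_pos (m k) p ltac:(lia)) as (u & v & Huv).
      rewrite H3 in Huv by lia.
      (* [u m_k = 1 + v p], hence [a + p v (m_k - 1) (f_k + a (m_k - 1))] is congruent to [f_k]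
         modulo [m_k]. *)
      exists (a + p * (v * (m k - 1) * (f k + a * (m k - 1)))), (p * m k). repeat split.
      + intros i Hi. destruct (Nat.eq_dec i k) as [->|Hne].
        * assert (E : exists q, a + p * (v * (m k - 1) * (f k + a * (m k - 1))) = f k + q * m k
                         \/ a + p * (v * (m k - 1) * (f k + a * (m k - 1))) + q * m k = f k).
          { set (M := m k - 1) in *. assert (EM : m k = S M) by lia. rewrite EM in *.
            replace (p * (v * M * (f k + a * M))) with ((v * p) * (M * (f k + a * M))) by ring.
            replace (v * p) with (u * S M - 1) by lia.
            destruct u as [|u]; [lia|].
            replace (S u * S M - 1) with (u * S M + M) by lia.
            destruct M as [|M].
            - exists a. left. assert (f k < 1) by (rewrite <- EM; auto). nia.
            - exists (u * (S M * (f k + a * S M)) + M * (f k + a * S M) + a). left. ring. }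
          destruct E as [q [E|E]].
          -- rewrite E, Nat.Div0.mod_add. apply Nat.mod_small. auto.
          -- rewrite <- (Nat.Div0.mod_add _ q), E. apply Nat.mod_small. auto.
        * destruct (H2 i ltac:(lia)) as [r Hr]. rewrite Hr.
          replace (r * m i * (v * (m k - 1) * (f k + a * (m k - 1))))
            with (r * (v * (m k - 1) * (f k + a * (m k - 1))) * m i) by ring.
          rewrite Nat.Div0.mod_add. apply H1. lia.
      + intros i Hi. destruct (Nat.eq_dec i k) as [->|Hne].
        * apply Nat.divide_factor_r.
        * apply Nat.divide_mul_l, H2. lia.
      + intros j Hj Hjn. apply Nat.divide_1_r.
        set (d := Nat.gcd (m j) (p * m k)).
        assert (Dj : Nat.divide d (m j)) by apply Nat.gcd_divide_l.
        assert (Dp : Nat.divide d (p * m k)) by apply Nat.gcd_divide_r.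
        apply Nat.gauss in Dp.
        * assert (E := Hc k j ltac:(lia) Hjn). rewrite <- E. now apply Nat.gcd_greatest.
        * apply Nat.divide_1_r. rewrite <- (H3 j) by lia. apply Nat.gcd_greatest.
          -- eapply Nat.divide_trans; [apply Nat.gcd_divide_l | exact Dj].
          -- apply Nat.gcd_divide_r. }
  destruct (H n (le_n n)) as (a & p & Ha & _). now exists a.
Qed.

Lemma bounded_below (f : nat -> nat) (n : nat) : exists B, forall i, i < n -> f i < B.
Proof.
  induction n as [|n [B HB]]; [exists 0; lia|]. exists (S (B + f n)). intros i Hi.
  destruct (Nat.eq_dec i n) as [->|Hne]; [lia|]. specialize (HB i). lia.
Qed.

Lemma beta_spec (f : nat -> nat) (n : nat) : exists c, forall i, i < n -> beta c i = f i.
Proof.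
  (* [M] bounds the indices, which makes the moduli [1 + (i + 1) M!] coprime, and also the values,
     which are therefore smaller than the moduli. *)
  destruct (bounded_below f n) as [B HB]. set (M := n + B).
  assert (HM : M <= fact M)
    by (clear; induction M as [|k IH]; simpl; [lia|]; pose proof (lt_O_fact k); nia).
  destruct (crt (fun i => S (S i * fact M)) f n) as [a Ha].
  - intros i j Hij Hj. apply beta_moduli_coprime; lia.
  - intros i Hi. specialize (HB i Hi). simpl. lia.
  - exists (cpair a (fact M)). intros i Hi. unfold beta. rewrite cfst_pair, csnd_pair. now apply Ha.
Qed.

Fixpoint prec (a : nat) (g : nat -> nat -> nat) (n : nat) : nat :=
  match n with 0 => a | S k => g k (prec a g k) end.

Ltac dp_match :=
  cbv beta;
  match goal with
  | |- dp (fun x e => @?P x e /\ @?Q x e) => apply (dp_and P Q)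
  | |- dp (fun x e => @?P x e \/ @?Q x e) => apply (dp_or P Q)
  | |- dp (fun x e => ~ @?P x e) => apply (dp_not P)
  | |- dp (fun x e => @eq nat (@?F x e) (@?G x e)) => apply (dp_eq F G)
  | |- dp (fun x e => @?F x e < @?G x e) => apply (dp_lt F G)
  | |- dp (fun x e => @?F x e <= @?G x e) => apply (dp_le F G)
  | |- dp (fun x e => exists a : nat, @?R x e a) => apply (dp_ex R)
  | |- dp (fun x e => @?P x e -> @?Q x e) => apply (dp_imp P Q)
  | |- dp (fun x e => forall a : nat, @?R x e a) => apply (dp_all R)
  | |- df (fun x e => e ?i) => apply (df_var i)
  | |- df (fun x e => S (@?F x e)) => apply (df_S F)
  | |- df (fun x e => @?F x e + @?G x e) => apply (df_add F G)
  | |- df (fun x e => @?F x e * @?G x e) => apply (df_mul F G)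
  | |- df (fun x e => x (@?F x e)) => apply (df_tf F)
  | |- df (fun x e => mu (@?P x e)) => apply (df_mu P)
  | |- df (fun x e => ite (@?P x e) (@?F x e) (@?G x e)) => apply (df_ite P F G)
  | |- df (fun x e => ?n) => apply (df_const n)
  | |- dfun _ => unfold dfun
  end.

Create HintDb arith_def.

Lemma df_cpair (A B : baire -> env -> nat) : df A -> df B -> df (fun x e => cpair (A x e) (B x e)).
Proof. intros HA HB. unfold cpair. repeat dp_match; assumption. Qed.

Lemma df_nat1 (F : nat -> nat) : df (fun x e => F (e 0)) ->
  forall A, df A -> df (fun x e => F (A x e)).
Proof. intros HF A HA. exact (df_fun1 (fun _ => F) HF _ A dfun_id HA). Qed.

Lemma df_nat2 (F : nat -> nat -> nat) : df (fun x e => F (e 0) (e 1)) ->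
  forall A B, df A -> df B -> df (fun x e => F (A x e) (B x e)).
Proof. intros HF A B HA HB. exact (df_fun2 (fun _ => F) HF _ A B dfun_id HA HB). Qed.

Lemma df_nat3 (F : nat -> nat -> nat -> nat) : df (fun x e => F (e 0) (e 1) (e 2)) ->
  forall A B C, df A -> df B -> df C -> df (fun x e => F (A x e) (B x e) (C x e)).
Proof. intros HF A B C HA HB HC. exact (df_fun3 (fun _ => F) HF _ A B C dfun_id HA HB HC). Qed.

Lemma dp_nat1 (R : nat -> Prop) : dp (fun x e => R (e 0)) ->
  forall A, df A -> dp (fun x e => R (A x e)).
Proof. intros HR A HA. exact (dp_rel1 (fun _ => R) HR _ A dfun_id HA). Qed.

Lemma dp_nat2 (R : nat -> nat -> Prop) : dp (fun x e => R (e 0) (e 1)) ->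
  forall A B, df A -> df B -> dp (fun x e => R (A x e) (B x e)).
Proof. intros HR A B HA HB. exact (dp_rel2 (fun _ => R) HR _ A B dfun_id HA HB). Qed.

Lemma dp_nat3 (R : nat -> nat -> nat -> Prop) : dp (fun x e => R (e 0) (e 1) (e 2)) ->
  forall A B C, df A -> df B -> df C -> dp (fun x e => R (A x e) (B x e) (C x e)).
Proof. intros HR A B C HA HB HC. exact (dp_rel3 (fun _ => R) HR _ A B C dfun_id HA HB HC). Qed.

#[export] Hint Resolve df_cpair dfun_id : arith_def.
#[export] Hint Extern 5 (dp _) => dp_match : arith_def.
#[export] Hint Extern 5 (df _) => dp_match : arith_def.
#[export] Hint Extern 5 (dfun _) => dp_match : arith_def.
Ltac dsolve := solve [eauto 100 with arith_def nocore].

Lemma df_cfst : forall A, df A -> df (fun x e => cfst (A x e)).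
Proof. apply df_nat1. unfold cfst. dsolve. Qed.

Lemma df_csnd : forall A, df A -> df (fun x e => csnd (A x e)).
Proof. apply df_nat1. unfold csnd. dsolve. Qed.

#[export] Hint Resolve df_cfst df_csnd : arith_def.

Lemma df_beta : forall A B, df A -> df B -> df (fun x e => beta (A x e) (B x e)).
Proof.
  apply df_nat2.
  apply (dp_iff (fun x e => exists q,
     cfst (e 1) = q * S (S (e 2) * csnd (e 1)) + e 0 /\ e 0 < S (S (e 2) * csnd (e 1)))).
  - intros x e. unfold beta. set (m := S (S (e 2) * csnd (e 1))). split.
    + intros ->. exists (cfst (e 1) / m). split; [|now apply Nat.mod_upper_bound].
      rewrite Nat.mul_comm. now apply Nat.div_mod.
    + intros [q [Hq Hl]]. apply (Nat.mod_unique _ _ q); [exact Hl|]. lia.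
  - dsolve.
Qed.
#[export] Hint Resolve df_beta : arith_def.

Lemma df_prec (A N : baire -> env -> nat) (g : baire -> env -> nat -> nat -> nat) :
  df A -> df (fun x e => g x (fun i => e (S (S i))) (e 0) (e 1)) -> df N ->
  df (fun x e => prec (A x e) (g x e) (N x e)).
Proof.
  intros HA Hg HN.
  (* The recursion is replaced by the existence of a number [c] coding its whole course of
     values. *)
  apply (dp_iff (fun x e => exists c, beta c 0 = A x (fun i => e (S i)) /\
     (forall i, i < N x (fun i => e (S i)) -> beta c (S i) = g x (fun i => e (S i)) i (beta c i)) /\
     e 0 = beta c (N x (fun i => e (S i))))).
  - intros x e. set (a := A x _). set (n := N x _). set (h := g x _). split.
    + intros ->. destruct (beta_spec (prec a h) (S n)) as [c Hc]. exists c. repeat split.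
      * rewrite Hc by lia. reflexivity.
      * intros i Hi. rewrite !Hc by lia. reflexivity.
      * now rewrite Hc by lia.
    + intros (c & H0 & HS & ->).
      assert (H : forall k, k <= n -> beta c k = prec a h k); [|now apply H].
      induction k as [|k IH]; intros Hk; simpl; [exact H0|].
      rewrite HS by lia. f_equal. apply IH. lia.
  - assert (HA2 := df_ren A (fun i => S (S i)) HA). assert (HN2 := df_ren N (fun i => S (S i)) HN).
    assert (HN3 := df_ren N (fun i => S (S (S i))) HN).
    assert (Hg3 : df (fun x e => g x (fun i => e (S (S (S i)))) (e 0) (beta (e 1) (e 0)))).
    { apply (df_subst (fun x e a => g x (fun i => e (S (S (S i)))) (e 0) a)); [|dsolve].
      exact (df_ren _ (fun i => match i with 0 => 1 | 1 => 0 | S (S j) => S (S (S (S j))) end) Hg). }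
    dsolve.
Qed.

(** * Prenex normal form *)

Inductive prenex : formula -> Prop :=
| prenex_qf p : quantifier_free p -> prenex p
| prenex_ex p : prenex p -> prenex (fex p)
| prenex_all p : prenex p -> prenex (fall p).

Definition fequiv (p q : formula) : Prop := forall x e, sat x e p <-> sat x e q.

(** The level is kept positive because quantifiers can be prefixed only there. A universal
    quantifier costs two levels, as the result is read as a Sigma formula again. *)
Lemma prenex_Sigma (p : formula) : prenex p -> exists n, is_Sigma (S n) p.
Proof.
  induction 1 as [p H|p _ [n IH]|p _ [n IH]].
  - exists 1. now apply SigmaPi, PiSigma, Sigma0.
  - exists n. now apply SigmaEx.
  - exists (S (S n)). now apply SigmaPi, PiAll, PiSigma.
Qed.

Lemma quantifier_free_fren (p : formula) : forall r, quantifier_free p -> quantifier_free (fren r p).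
Proof. induction p; simpl; intuition auto. Qed.

Lemma prenex_fren (p : formula) : prenex p -> forall r, prenex (fren r p).
Proof.
  induction 1 as [p H|p H IH|p H IH]; intros r.
  - now apply prenex_qf, quantifier_free_fren.
  - apply prenex_ex, IH.
  - apply prenex_all, IH.
Qed.

Lemma sat_shift (x : baire) (e : env) (a : nat) (q : formula) :
  sat x (scons a e) (fren S q) <-> sat x e q.
Proof. now apply sat_fren. Qed.

Lemma prenex_not (p : formula) : prenex p -> exists q, prenex q /\ fequiv q (fnot p).
Proof.
  induction 1 as [p H|p _ [q [Hq E]]|p _ [q [Hq E]]].
  - exists (fnot p). split; [now apply prenex_qf|]. intros x e. reflexivity.
  - exists (fall q). split; [now apply prenex_all|]. intros x e. simpl. split.
    + intros H [a Ha]. now apply (E x (scons a e)) in Ha.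
    + intros H a. apply E. simpl. eauto.
  - exists (fex q). split; [now apply prenex_ex|]. intros x e. simpl. split.
    + intros [a Ha] H. apply E in Ha. exact (Ha (H a)).
    + intros H. apply not_all_ex_not in H. destruct H as [a Ha]. exists a. now apply E.
Qed.

(** The quantifiers of [p] are pulled out first, then those of [q] past a quantifier-free conjunct.
    For universal quantifiers the other conjunct is recovered at the instance 0. *)
Lemma prenex_and (p : formula) : prenex p -> forall q, prenex q ->
  exists r, prenex r /\ fequiv r (fand p q).
Proof.
  assert (Hqf : forall q, prenex q -> forall p, quantifier_free p ->
            exists r, prenex r /\ fequiv r (fand p q)).
  { induction 1 as [q Hq|q _ IH|q _ IH]; intros p' Hp.
    - exists (fand p' q). split; [now apply prenex_qf|]. intros x e. reflexivity.
    - destruct (IH (fren S p')) as [r [Hr E]]; [now apply quantifier_free_fren|].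
      exists (fex r). split; [now apply prenex_ex|]. intros x e. simpl. split.
      + intros [a Ha]. apply E in Ha. destruct Ha as [H1 H2]. apply sat_shift in H1. eauto.
      + intros [H1 [a H2]]. exists a. apply E. split; [now apply sat_shift | exact H2].
    - destruct (IH (fren S p')) as [r [Hr E]]; [now apply quantifier_free_fren|].
      exists (fall r). split; [now apply prenex_all|]. intros x e. simpl. split.
      + intros H. split; [specialize (H 0); apply E in H; destruct H as [H _]; now apply sat_shift in H|].
        intros a. specialize (H a). apply E in H. apply H.
      + intros [H1 H2] a. apply E. split; [now apply sat_shift | apply H2]. }
  induction 1 as [p Hp|p _ IH|p _ IH]; intros q Hq; [now apply Hqf| |];
    destruct (IH (fren S q)) as [r [Hr E]]; try (now apply prenex_fren).
  - exists (fex r). split; [now apply prenex_ex|]. intros x e. simpl. split.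
    + intros [a Ha]. apply E in Ha. destruct Ha as [H1 H2]. apply sat_shift in H2. eauto.
    + intros [[a H1] H2]. exists a. apply E. split; [exact H1 | now apply sat_shift].
  - exists (fall r). split; [now apply prenex_all|]. intros x e. simpl. split.
    + intros H. split; [|specialize (H 0); apply E in H; destruct H as [_ H]; now apply sat_shift in H].
      intros a. specialize (H a). apply E in H. apply H.
    + intros [H1 H2] a. apply E. split; [apply H1 | now apply sat_shift].
Qed.

Lemma prenex_form (p : formula) : exists q, prenex q /\ fequiv q p.
Proof.
  induction p as [t u|t u|p [q [Hq E]]|p1 [q1 [Hq1 E1]] p2 [q2 [Hq2 E2]]
                 |p1 [q1 [Hq1 E1]] p2 [q2 [Hq2 E2]]|p [q [Hq E]]|p [q [Hq E]]].
  - exists (feq t u). split; [now apply prenex_qf|]. intros x e. reflexivity.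
  - exists (flt t u). split; [now apply prenex_qf|]. intros x e. reflexivity.
  - destruct (prenex_not q Hq) as [r [Hr F]]. exists r. split; [exact Hr|]. intros x e.
    rewrite (F x e). simpl. now rewrite (E x e).
  - destruct (prenex_and q1 Hq1 q2 Hq2) as [r [Hr F]]. exists r. split; [exact Hr|]. intros x e.
    rewrite (F x e). simpl. now rewrite (E1 x e), (E2 x e).
  - destruct (prenex_not q1 Hq1) as [n1 [Hn1 F1]]. destruct (prenex_not q2 Hq2) as [n2 [Hn2 F2]].
    destruct (prenex_and n1 Hn1 n2 Hn2) as [r [Hr F]]. destruct (prenex_not r Hr) as [s [Hs Fs]].
    exists s. split; [exact Hs|]. intros x e.
    rewrite (Fs x e). simpl. rewrite (F x e). simpl. rewrite (F1 x e), (F2 x e). simpl.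
    rewrite (E1 x e), (E2 x e). tauto.
  - exists (fex q). split; [now apply prenex_ex|]. intros x e. simpl.
    split; intros [a Ha]; exists a; now apply E.
  - exists (fall q). split; [now apply prenex_all|]. intros x e. simpl.
    split; intros H a; now apply E.
Qed.

Lemma term_closed_mono (t : term) (k k' : nat) : k <= k' -> term_closed k t -> term_closed k' t.
Proof. intros Hk. induction t; simpl; intuition lia. Qed.

Lemma closed_below_mono (p : formula) : forall k k', k <= k' -> closed_below k p -> closed_below k' p.
Proof.
  induction p; simpl; intros k k' Hk H.
  1,2: split; apply (term_closed_mono _ k k' Hk); apply H.
  - now apply (IHp k).
  - split; [apply (IHp1 k) | apply (IHp2 k)]; tauto.
  - split; [apply (IHp1 k) | apply (IHp2 k)]; tauto.
  - apply (IHp (S k)); [lia | exact H].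
  - apply (IHp (S k)); [lia | exact H].
Qed.

Lemma term_closed_exists (t : term) : exists k, term_closed k t.
Proof.
  induction t as [i| |t [k IH]|t [k IH] u [l IH']|t [k IH] u [l IH']|t [k IH]]; simpl;
    eauto; try (now exists 0); try (now exists (S i); lia).
  all: exists (k + l); split; (eapply term_closed_mono; [|eassumption]); lia.
Qed.

Lemma closed_below_exists (p : formula) : exists k, closed_below k p.
Proof.
  induction p as [t u|t u|p [k IH]|p [k IH] q [l IH']|p [k IH] q [l IH']|p [k IH]|p [k IH]]; simpl;
    try (destruct (term_closed_exists t) as [k IH], (term_closed_exists u) as [l IH']).
  1,2: exists (k + l); split; (eapply term_closed_mono; [|eassumption]); lia.
  - now exists k.
  - exists (k + l); split; (eapply closed_below_mono; [|eassumption]); lia.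
  - exists (k + l); split; (eapply closed_below_mono; [|eassumption]); lia.
  - exists k. eapply closed_below_mono; [|eassumption]; lia.
  - exists k. eapply closed_below_mono; [|eassumption]; lia.
Qed.

Lemma dp_arithmetical (G : baire -> Prop) : dp (fun x e => G x) -> arithmetical G.
Proof.
  intros [p Hp]. destruct (prenex_form p) as [q [Hq E]].
  assert (Hq' : forall x e, G x <-> sat x e q) by (intros; rewrite (Hp x e); symmetry; apply E).
  clear p Hp E. destruct (closed_below_exists q) as [k Hk].
  (* The truth value does not depend on the environment, so quantifying the free variables is harmless. *)
  revert q Hq Hq' Hk. induction k as [|k IH]; intros q Hq Hq' Hk.
  - destruct (prenex_Sigma q Hq) as [n Hn]. exists (S n), q. auto.
  - apply (IH (fex q)); [now apply prenex_ex| |exact Hk].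
    intros x e. simpl. split.
    + intros H. exists 0. now apply Hq'.
    + intros [a Ha]. now apply Hq' in Ha.
Qed.

(** * Words of involutions *)

Definition run {T V : Type} (act : T -> V -> V) (l : list T) (v : V) : V := fold_right act v l.

Fixpoint red {T : Type} (l : list T) : Prop :=
  match l with [] => True | a :: l' => hd_error l' <> Some a /\ red l' end.

Lemma run_app {T V : Type} (act : T -> V -> V) (l l' : list T) (v : V) :
  run act (l ++ l') v = run act l (run act l' v).
Proof. apply fold_right_app. Qed.

Lemma run_rev {T V : Type} (act : T -> V -> V) (P : T -> Prop) (l : list T) (v : V) :
  (forall a u, P a -> act a (act a u) = u) -> Forall P l -> run act (rev l) (run act l v) = v.
Proof.
  intros Hact. induction 1 as [|a l Ha Hl IH]; simpl; [reflexivity|].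
  rewrite run_app. simpl. now rewrite Hact.
Qed.

Lemma run_inj {T V : Type} (act : T -> V -> V) (P : T -> Prop) (l : list T) (u v : V) :
  (forall a u, P a -> act a (act a u) = u) -> Forall P l -> run act l u = run act l v -> u = v.
Proof.
  intros Hact Hl E. rewrite <- (run_rev act P l u Hact Hl), E. now apply run_rev with P.
Qed.

Lemma red_app_l {T : Type} (l l' : list T) : red (l ++ l') -> red l.
Proof.
  induction l as [|a l IH]; simpl; [auto|]. intros [H1 H2]. split; [|auto].
  destruct l; simpl in *; [discriminate | exact H1].
Qed.

Lemma red_app_r {T : Type} (l l' : list T) : red (l ++ l') -> red l'.
Proof. induction l as [|a l IH]; simpl; [auto|]. intros [_ H]. auto. Qed.

Lemma red_app {T : Type} (l l' : list T) :
  red l -> red l' -> (forall a k, l = k ++ [a] -> hd_error l' <> Some a) -> red (l ++ l').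
Proof.
  induction l as [|a l IH]; simpl; [auto|]. intros [H1 H2] H' H. split.
  - destruct l as [|b l]; simpl in *; [|exact H1]. now apply (H a []).
  - apply IH; auto. intros b k E. apply (H b (a :: k)). now rewrite E.
Qed.

Lemma red_rev {T : Type} (l : list T) : red l -> red (rev l).
Proof.
  induction l as [|a l IH]; simpl; [auto|]. intros [H1 H2].
  apply red_app; [auto | simpl; split; [discriminate | exact I]|].
  intros b k E. simpl. intros [= <-]. apply H1.
  apply (f_equal (@rev T)) in E. rewrite rev_involutive, rev_app_distr in E. now rewrite E.
Qed.

Lemma red_map {T T' : Type} (f : T -> T') (l : list T) :
  (forall a b, In a l -> In b l -> f a = f b -> a = b) -> red l -> red (map f l).
Proof.
  induction l as [|a l IH]; simpl; [auto|]. intros Hf [H1 H2]. split.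
  - destruct l as [|b l]; simpl in *; [discriminate|]. intros [= E]. apply H1. f_equal.
    apply Hf; auto.
  - apply IH; [|exact H2]. intros; apply Hf; auto.
Qed.

Lemma reduce {T V : Type} (act : T -> V -> V) (P : T -> Prop) (l : list T) :
  (forall a u, P a -> act a (act a u) = u) -> Forall P l ->
  exists l', red l' /\ incl l' l /\ length l' <= length l /\ forall v, run act l' v = run act l v.
Proof.
  intros Hact. induction 1 as [|a l Ha Hl (k & H1 & H2 & H3 & H4)].
  - exists []. simpl. auto using incl_refl.
  - destruct (classic (hd_error k = Some a)) as [E|E].
    + destruct k as [|b k]; simpl in E; [discriminate|]. injection E as ->.
      exists k. simpl in *. repeat split; [apply H1 | | lia |].
      * intros c Hc. right. apply H2. now right.
      * intros v. rewrite <- (H4 v). simpl. now rewrite Hact.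
    + exists (a :: k). repeat split; [exact E | exact H1 | | simpl; lia |].
      * intros c [->|Hc]; [now left | right; auto].
      * intros v. simpl. now rewrite H4.
Qed.

(** Equal first letters cancel. Once they differ, the reverse of one word followed by the other is
    reduced and fixes [v], so freeness up to length [K] is contradicted. *)
Lemma red_unique {T V : Type} (act : T -> V -> V) (P : T -> Prop) (I : V -> Prop) (K : nat) :
  (forall a u, P a -> act a (act a u) = u) -> (forall a u, P a -> I u -> I (act a u)) ->
  (forall w v, w <> [] -> red w -> Forall P w -> length w <= K -> I v -> run act w v <> v) ->
  forall u w v, red u -> red w -> Forall P u -> Forall P w -> length u + length w <= K -> I v ->
    run act u v = run act w v -> u = w.
Proof.
  intros Hact HI Hfree. induction u as [|s u IH]; intros w v Hu Hw Pu Pw HK Hv E.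
  - destruct w as [|t w]; [reflexivity|]. exfalso.
    apply (Hfree (t :: w) v); auto. discriminate.
  - destruct w as [|t w].
    + exfalso. apply (Hfree (s :: u) v); auto; try discriminate. simpl in *; lia.
    + destruct (classic (s = t)) as [<-|Hne].
      * f_equal. inversion Pu; inversion Pw; subst. apply (IH w v); auto; try apply Hu; try apply Hw.
        -- simpl in HK. lia.
        -- simpl in E. rewrite <- (Hact s (run act u v)), E by assumption. now apply Hact.
      * exfalso. apply (Hfree (rev (s :: u) ++ t :: w) v); auto.
        -- intros E'. apply app_eq_nil in E'. destruct E' as [_ E']. discriminate.
        -- apply red_app; [now apply red_rev | exact Hw|]. simpl. intros a k E'.
           apply app_inj_tail in E'. destruct E' as [_ <-]. congruence.
        -- apply Forall_app. split; [now apply Forall_rev | exact Pw].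
        -- rewrite length_app, length_rev. exact HK.
        -- rewrite run_app, <- E. now apply run_rev with P.
Qed.

(** * Finite graphs of large girth *)

Fixpoint tuples {T : Type} (k : nat) (B : list T) : list (list T) :=
  match k with 0 => [[]] | S k => flat_map (fun b => map (cons b) (tuples k B)) B end.

Lemma in_tuples {T : Type} (k : nat) (B z : list T) : In z (tuples k B) <-> length z = k /\ incl z B.
Proof.
  revert z. induction k as [|k IH]; intros z; simpl.
  - split.
    + intros [<-|[]]. split; [reflexivity | apply incl_nil_l].
    + intros [H _]. left. symmetry. now apply length_zero_iff_nil.
  - rewrite in_flat_map. split.
    + intros (b & Hb & Hz). apply in_map_iff in Hz. destruct Hz as (y & <- & Hy).
      apply IH in Hy. destruct Hy as [H1 H2]. simpl. split; [lia|]. now apply incl_cons.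
    + destruct z as [|b z]; simpl; intros [H1 H2]; [discriminate|].
      exists b. split; [apply H2; now left|]. apply in_map. apply IH. split; [lia|].
      intros c Hc. apply H2. now right.
Qed.

Fixpoint words (A L : nat) : list (list nat) :=
  match L with
  | 0 => [[]]
  | S L => [] :: flat_map (fun s => map (cons s) (words A L)) (seq 0 A)
  end.

Lemma in_words (A L : nat) (w : list nat) :
  In w (words A L) <-> length w <= L /\ Forall (fun s => s < A) w.
Proof.
  revert w. induction L as [|L IH]; intros w; simpl.
  - split.
    + intros [<-|[]]. auto.
    + intros [H _]. left. symmetry. apply length_zero_iff_nil. lia.
  - rewrite in_flat_map. split.
    + intros [<-|(s & Hs & Hw)]; [simpl; split; [lia | auto]|].
      apply in_map_iff in Hw. destruct Hw as (y & <- & Hy). apply IH in Hy.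
      apply in_seq in Hs. simpl. split; [lia|]. constructor; [lia | tauto].
    + intros [H1 H2]. destruct w as [|s w]; [now left|]. right. inversion H2; subst.
      exists s. split; [apply in_seq; lia|]. apply in_map, IH. simpl in H1. split; [lia | assumption].
Qed.

Fixpoint lead (s : nat) (w : list nat) : nat :=
  match w with [] => 0 | a :: w => if Nat.eq_dec a s then S (lead s w) else 0 end.

(* Left multiplication by [s] in the ball of radius [L] of a free product of groups of order two,
   corrected at the boundary; words that are not reduced are paired up by the parity of the number
   of leading letters [s]. *)
Definition toggle (A L s : nat) (w : list nat) : list nat :=
  if lt_dec s A then
    if Nat.even (lead s w) then if lt_dec (length w) L then s :: w else w
    else tl w
  else w.

Lemma toggle_involutive (A L s : nat) (w : list nat) :
  length w <= L -> toggle A L s (toggle A L s w) = w.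
Proof.
  intros Hw. unfold toggle. destruct (lt_dec s A) as [Hs|]; [|reflexivity].
  destruct (Nat.even (lead s w)) eqn:E.
  - destruct (lt_dec (length w) L) as [Hl|Hl].
    + simpl lead. destruct (Nat.eq_dec s s); [|easy].
      rewrite Nat.even_succ, <- Nat.negb_even, E. reflexivity.
    + rewrite E. now destruct (lt_dec (length w) L).
  - destruct w as [|a w]; simpl in *; [discriminate|].
    destruct (Nat.eq_dec a s) as [->|]; [|discriminate].
    rewrite Nat.even_succ, <- Nat.negb_even in E.
    destruct (Nat.even (lead s w)); [|discriminate].
    destruct (lt_dec (length w) L); [reflexivity | lia].
Qed.

Lemma toggle_words (A L s : nat) (w : list nat) :
  In w (words A L) -> In (toggle A L s w) (words A L).
Proof.
  rewrite !in_words. intros [H1 H2]. unfold toggle.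
  destruct (lt_dec s A); [|auto]. destruct (Nat.even _).
  - destruct (lt_dec (length w) L); [|auto]. simpl. split; [lia | auto].
  - destruct w; simpl in *; [auto|]. inversion H2. split; [lia | auto].
Qed.

(** Nothing cancels in a reduced word and the boundary of the ball is not exceeded, so each letter
    is simply prefixed. Hence a nonempty short reduced word moves the empty word. *)
Lemma run_toggle_nil (A L : nat) (w : list nat) :
  red w -> length w <= L -> Forall (fun s => s < A) w -> run (toggle A L) w [] = w.
Proof.
  induction w as [|s w IH]; simpl; [reflexivity|]. intros [H1 H2] HL HF. inversion HF; subst.
  fold (run (toggle A L) w []). rewrite IH by (auto; lia). unfold toggle.
  destruct (lt_dec s A); [|easy].
  assert (E : lead s w = 0).
  { destruct w as [|a w]; simpl in *; [reflexivity|]. destruct (Nat.eq_dec a s); congruence. }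
  rewrite E. simpl. destruct (lt_dec (length w) L); [reflexivity | lia].
Qed.

(** Levels have to be intervals of natural numbers, so a finite action is transported along an
    enumeration of its vertices. *)
Lemma numbering {T S : Type} (U : list T) (act : S -> T -> T) (P : list S -> Prop) :
  NoDup U -> (forall s u, In u U -> In (act s u) U) -> (forall s u, In u U -> act s (act s u) = u) ->
  (forall w u, P w -> In u U -> run act w u <> u) ->
  exists act' : S -> nat -> nat,
    (forall s v, v < length U -> act' s v < length U) /\
    (forall s v, v < length U -> act' s (act' s v) = v) /\
    (forall w v, P w -> v < length U -> run act' w v <> v).
Proof.
  intros Hnd Hin Hinv Hfree.
  destruct U as [|d U0]; [exists (fun _ v => v); simpl; repeat split; intros; lia|].
  set (U := d :: U0) in *. clearbody U.
  set (nm := fun i => nth i U d). set (idx := fun u => mu (fun i => i < length U /\ nm i = u)).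
  assert (N1 : forall u, In u U -> idx u < length U /\ nm (idx u) = u).
  { intros u Hu. destruct (In_nth U u d Hu) as (i & Hi & E).
    exact (mu_in (fun i => i < length U /\ nm i = u) i (conj Hi E)). }
  assert (N2 : forall i, i < length U -> In (nm i) U) by (intros; now apply nth_In).
  assert (N3 : forall i, i < length U -> idx (nm i) = i).
  { intros i Hi. destruct (N1 (nm i) (N2 i Hi)) as [H1 H2].
    apply (proj1 (NoDup_nth U d) Hnd); auto. }
  set (act' := fun s v => idx (act s (nm v))).
  assert (H1 : forall s v, v < length U -> act' s v < length U) by (intros; apply N1; auto).
  exists act'. split; [exact H1|]. split.
  - intros s v Hv. unfold act'. rewrite (proj2 (N1 _ (Hin s _ (N2 v Hv)))), Hinv by auto. auto.
  - intros w v Hw Hv E. apply (Hfree w (nm v) Hw (N2 v Hv)). rewrite <- E at 2.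
    clear E Hw Hfree.
    assert (H : run act' w v < length U /\ nm (run act' w v) = run act w (nm v)); [|symmetry; apply H].
    induction w as [|s w [IH1 IH2]]; simpl; [auto|].
    fold (run act' w v) (run act w (nm v)). split; [auto|]. unfold act' at 1. rewrite IH2.
    apply N1. apply Hin. rewrite <- IH2. auto.
Qed.

Lemma graph_exists (A L q : nat) :
  exists (sz : nat) (act : nat -> nat -> nat), q <= sz /\
    (forall s v, v < sz -> act s v < sz) /\
    (forall s v, v < sz -> act s (act s v) = v) /\
    (forall w v, (w <> [] /\ red w /\ length w <= L /\ Forall (fun s => s < A) w) ->
       v < sz -> run act w v <> v).
Proof.
  (* The vertices are the enumerations [z] of the whole ball, in [q] copies: a word fixing [z] fixes
     every point of the ball, in particular the empty word. *)
  set (B := words A L).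
  set (full := fun z : list (list nat) => incl B z).
  set (V := filter (fun z => if excluded_middle_informative (full z) then true else false)
              (tuples (length B) B)).
  assert (HV : forall z, In z V <-> (length z = length B /\ incl z B) /\ full z).
  { intros z. unfold V. rewrite filter_In, in_tuples.
    destruct (excluded_middle_informative (full z)); intuition congruence. }
  set (eqd := fun a b : list (list nat) * nat => excluded_middle_informative (a = b)).
  set (U := nodup eqd (list_prod V (seq 0 q))).
  assert (HU : forall z i, In (z, i) U <-> In z V /\ i < q).
  { intros z i. unfold U. rewrite nodup_In, in_prod_iff, in_seq. intuition lia. }
  set (act := fun s (u : list (list nat) * nat) => (map (toggle A L s) (fst u), snd u)).
  assert (Hinv : forall s z, incl z B -> map (toggle A L s) (map (toggle A L s) z) = z).
  { intros s z Hz. rewrite map_map. rewrite <- (map_id z) at 2. apply map_ext_in.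
    intros w Hw. apply toggle_involutive. apply (in_words A L w). now apply Hz. }
  destruct (numbering U act
    (fun w => w <> [] /\ red w /\ length w <= L /\ Forall (fun s => s < A) w)) as (act' & H1 & H2 & H3).
  - apply NoDup_nodup.
  - intros s [z i]. change (act s (z, i)) with (map (toggle A L s) z, i).
    rewrite !HU, !HV, length_map. intros [[[Hl Hz] Hf] Hi]. repeat split; auto.
    + intros w Hw. apply in_map_iff in Hw. destruct Hw as (y & <- & Hy). now apply toggle_words, Hz.
    + intros w Hw. rewrite <- (toggle_involutive A L s w) by (now apply (in_words A L w)).
      apply in_map, Hf. now apply toggle_words.
  - intros s [z i]. rewrite HU, HV. intros [[[_ Hz] _] _]. unfold act. simpl. now rewrite Hinv.
  - intros w [z i] (Hne & Hred & HL & HA). rewrite HU, HV. intros [[[_ Hz] Hf] Hi] E.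
    assert (E' : run act w (z, i) = (map (run (toggle A L) w) z, i)).
    { clear. induction w as [|s w IH]; simpl; [now rewrite map_id|].
      fold (run act w (z, i)). rewrite IH. unfold act. simpl. now rewrite map_map. }
    rewrite E' in E. injection E as E.
    assert (Hall : forall y, In y z -> run (toggle A L) w y = y).
    { rewrite <- (map_id z) in E at 2. intros y Hy. now apply (ext_in_map E). }
    apply Hne. rewrite <- (run_toggle_nil A L w Hred HL HA). apply Hall, Hf.
    apply in_words. simpl. split; [lia | auto].
  - exists (length U), act'. split; [|auto].
    rewrite <- (length_seq q 0), <- (length_map (fun i => (B, i))). apply NoDup_incl_length.
    + apply Injective_map_NoDup; [intros i j [= E]; exact E | apply seq_NoDup].
    + intros [z i] Hzi. apply in_map_iff in Hzi. destruct Hzi as (j & [= <- <-] & Hj).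
      apply in_seq in Hj. apply HU. split; [|lia]. apply HV. repeat split; auto using incl_refl.
      unfold full. apply incl_refl.
Qed.

(** * Lists coded by numbers *)

(** Index 0 is the last entry. Since [run] applies the last entry first, running along [mk f k] is
    primitive recursion upwards, as [run_mk] states. *)
Fixpoint mk {T : Type} (f : nat -> T) (k : nat) : list T :=
  match k with 0 => [] | S k => f k :: mk f k end.

Lemma length_mk {T : Type} (f : nat -> T) (k : nat) : length (mk f k) = k.
Proof. induction k; simpl; auto. Qed.

Lemma in_mk {T : Type} (f : nat -> T) (k : nat) (a : T) : In a (mk f k) <-> exists i, i < k /\ f i = a.
Proof.
  induction k as [|k IH]; simpl.
  - split; [intros []|]. intros (i & H & _). lia.
  - rewrite IH. split.
    + intros [E|(i & Hi & E)]; [exists k | exists i]; split; auto.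
    + intros (i & Hi & E). destruct (Nat.eq_dec i k) as [->|]; [now left|].
      right. exists i. split; [lia | exact E].
Qed.

Lemma Forall_mk {T : Type} (P : T -> Prop) (f : nat -> T) (k : nat) :
  Forall P (mk f k) <-> forall i, i < k -> P (f i).
Proof.
  rewrite Forall_forall. split.
  - intros H i Hi. apply H, in_mk. eauto.
  - intros H a Ha. apply in_mk in Ha. destruct Ha as (i & Hi & <-). auto.
Qed.

Lemma red_mk {T : Type} (f : nat -> T) (k : nat) :
  red (mk f k) <-> forall i, S i < k -> f (S i) <> f i.
Proof.
  induction k as [|k IH]; simpl.
  - split; [intros _ i Hi; lia | auto].
  - rewrite IH. split.
    + intros [H1 H2] i Hi. destruct (Nat.eq_dec (S i) k) as [<-|]; [|apply H2; lia].
      simpl in H1. congruence.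
    + intros H. split.
      * destruct k as [|k]; simpl; [discriminate|]. intros [= E]. apply (H k); [lia | auto].
      * intros i Hi. apply H. lia.
Qed.

Lemma run_mk {T : Type} (act : T -> nat -> nat) (f : nat -> T) (k v : nat) :
  run act (mk f k) v = prec v (fun i acc => act (f i) acc) k.
Proof. induction k as [|k IH]; simpl; [reflexivity|]. f_equal. exact IH. Qed.

Lemma mk_ext {T : Type} (f g : nat -> T) (k : nat) : (forall i, i < k -> f i = g i) -> mk f k = mk g k.
Proof. induction k as [|k IH]; simpl; intros H; [reflexivity|]. f_equal; auto. Qed.

Lemma map_mk {T T' : Type} (h : T -> T') (f : nat -> T) (k : nat) :
  map h (mk f k) = mk (fun i => h (f i)) k.
Proof. induction k as [|k IH]; simpl; [reflexivity|]. now f_equal. Qed.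

Lemma mk_inj {T : Type} (f g : nat -> T) (k i : nat) : mk f k = mk g k -> i < k -> f i = g i.
Proof.
  induction k as [|k IH]; simpl; intros E Hi; [lia|]. injection E as E1 E2.
  destruct (Nat.eq_dec i k) as [->|]; [exact E1|]. apply IH; [exact E2 | lia].
Qed.

Lemma mk_surj {T : Type} (d : T) (l : list T) : exists f, l = mk f (length l).
Proof.
  induction l as [|a l [f IH]]; simpl; [now exists (fun _ => d)|].
  exists (fun i => if Nat.eq_dec i (length l) then a else f i).
  destruct (Nat.eq_dec (length l) (length l)); [|easy]. f_equal.
  rewrite IH at 1. apply mk_ext. intros i Hi. destruct (Nat.eq_dec i (length l)); [lia | reflexivity].
Qed.

Definition el (p i : nat) : nat := beta (cfst p) i.
Definition dl (p : nat) : list nat := mk (el p) (csnd p).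

Lemma dl_surj (l : list nat) : exists p, dl p = l.
Proof.
  destruct (mk_surj 0 l) as [f E]. destruct (beta_spec f (length l)) as [c Hc].
  exists (cpair c (length l)). transitivity (mk f (length l)); [|now symmetry].
  unfold dl, el. rewrite cfst_pair, csnd_pair. now apply mk_ext.
Qed.

Lemma length_dl (p : nat) : length (dl p) = csnd p.
Proof. apply length_mk. Qed.

Lemma df_el : forall A B, df A -> df B -> df (fun x e => el (A x e) (B x e)).
Proof. apply df_nat2. unfold el. dsolve. Qed.
#[export] Hint Resolve df_el : arith_def.

Lemma df_length_dl : forall A, df A -> df (fun x e => length (dl (A x e))).
Proof.
  apply (df_nat1 (fun a => length (dl a))).
  apply (df_eqfun (fun x e => csnd (e 0))); [intros; apply length_dl | dsolve].
Qed.
#[export] Hint Resolve df_length_dl : arith_def.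

Lemma dp_red_dl : forall A, df A -> dp (fun x e => red (dl (A x e))).
Proof.
  apply (dp_nat1 (fun a => red (dl a))).
  apply (dp_iff (fun x e => forall i, S i < csnd (e 0) -> el (e 0) (S i) <> el (e 0) i)).
  - intros x e. apply red_mk.
  - dsolve.
Qed.
#[export] Hint Resolve dp_red_dl : arith_def.

Lemma dp_in_dl : forall A B, df A -> df B -> dp (fun x e => In (A x e) (dl (B x e))).
Proof.
  apply (dp_nat2 (fun a b => In a (dl b))).
  apply (dp_iff (fun x e => exists i, i < csnd (e 1) /\ el (e 1) i = e 0)).
  - intros x e. apply in_mk.
  - dsolve.
Qed.
#[export] Hint Resolve dp_in_dl : arith_def.

Lemma dp_Forall_dl (R : baire -> env -> nat -> Prop) (A : baire -> env -> nat) :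
  dp (fun x e => R x (fun i => e (S i)) (e 0)) -> df A -> dp (fun x e => Forall (R x e) (dl (A x e))).
Proof.
  intros HR HA. apply (dp_iff (fun x e => forall i, i < csnd (A x e) -> R x e (el (A x e) i))).
  - intros x e. apply Forall_mk.
  - assert (HA' := df_ren A S HA). apply dp_all. apply dp_imp; [dsolve|].
    apply (dp_subst (fun x e a => R x (fun i => e (S i)) a)); [|dsolve].
    exact (dp_ren _ (fun i => match i with 0 => 0 | S j => S (S j) end) HR).
Qed.

Lemma df_run_dl (F : baire -> env -> nat -> nat -> nat) (A V : baire -> env -> nat) :
  df (fun x e => F x (fun i => e (S (S i))) (e 0) (e 1)) -> df A -> df V ->
  df (fun x e => run (F x e) (dl (A x e)) (V x e)).
Proof.
  intros HF HA HV.
  apply (df_eqfun (fun x e => prec (V x e) (fun i acc => F x e (el (A x e) i) acc) (csnd (A x e)))).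
  - intros x e. apply run_mk.
  - apply (df_prec V (fun x e => csnd (A x e)) (fun x e i acc => F x e (el (A x e) i) acc));
      [exact HV| |dsolve].
    assert (HA2 := df_ren A (fun i => S (S i)) HA).
    apply (df_subst (fun x e a => F x (fun i => e (S (S i))) a (e 1))); [|dsolve].
    exact (df_ren _ (fun i => match i with 0 => 0 | 1 => 2 | S (S j) => S (S (S j)) end) HF).
Qed.

Ltac dp_match_dl :=
  cbv beta;
  match goal with
  | |- dp (fun x e => Forall (@?R x e) (dl (@?A x e))) => apply (dp_Forall_dl R A)
  | |- df (fun x e => run (@?F x e) (dl (@?A x e)) (@?V x e)) => apply (df_run_dl F A V)
  | |- df (fun x e => prec (@?A x e) (@?g x e) (@?N x e)) => apply (df_prec A N g)
  end.
#[export] Hint Extern 3 (dp _) => dp_match_dl : arith_def.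
#[export] Hint Extern 3 (df _) => dp_match_dl : arith_def.

Lemma df_sub : forall A B, df A -> df B -> df (fun x e => A x e - B x e).
Proof.
  apply df_nat2.
  apply (dp_iff (fun x e => (e 2 <= e 1 /\ e 0 + e 2 = e 1) \/ (e 1 < e 2 /\ e 0 = 0))).
  - intros x e. lia.
  - dsolve.
Qed.
#[export] Hint Resolve df_sub : arith_def.

(** * Binary codes of reals *)

Definition bits (x : baire) : Prop := forall k, x k < 2.

(** The binary numeral with leading digit 1 followed by [x 0], ..., [x (n - 1)]; it lies below
    [letters n], which is 2 to the power [n + 1]. *)
Definition bcode (x : baire) (n : nat) : nat := prec 1 (fun k acc => acc + acc + x k) n.

Definition letters (n : nat) : nat := prec 2 (fun _ a => a + a) n.

Lemma bcode_lt (x : baire) (n : nat) : (forall k, k < n -> x k < 2) -> bcode x n < letters n.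
Proof.
  unfold bcode, letters. induction n as [|n IH]; simpl; intros Hx; [lia|].
  specialize (IH (fun k Hk => Hx k (Nat.lt_lt_succ_r _ _ Hk))). specialize (Hx n). lia.
Qed.

Lemma bcode_inj (x y : baire) (n : nat) :
  (forall k, k < n -> x k < 2) -> (forall k, k < n -> y k < 2) -> bcode x n = bcode y n ->
  forall k, k < n -> x k = y k.
Proof.
  unfold bcode. induction n as [|n IH]; simpl; intros Hx Hy E k Hk; [lia|].
  assert (Hxn := Hx n). assert (Hyn := Hy n).
  assert (prec 1 (fun k acc => acc + acc + x k) n = prec 1 (fun k acc => acc + acc + y k) n) by lia.
  destruct (Nat.eq_dec k n) as [->|]; [lia|]. apply IH; auto; lia.
Qed.

Lemma bcode_ext (x y : baire) (n : nat) : (forall k, k < n -> x k = y k) -> bcode x n = bcode y n.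
Proof.
  unfold bcode. induction n as [|n IH]; simpl; intros H; [reflexivity|]. rewrite IH, H by auto. reflexivity.
Qed.

Lemma bits_distinct (x y : baire) : bits x -> bits y -> x <> y ->
  exists N, forall n, N <= n -> bcode x n <> bcode y n.
Proof.
  intros Hx Hy Hne. destruct (classic (exists k, x k <> y k)) as [[k Hk]|Hn].
  - exists (S k). intros n Hn E. apply Hk. apply (bcode_inj x y n); auto.
  - exfalso. apply Hne. apply functional_extensionality. intros k. apply NNPP. eauto.
Qed.

Lemma df_letters : forall A, df A -> df (fun x e => letters (A x e)).
Proof. apply df_nat1. unfold letters. dsolve. Qed.

Lemma df_bcode : forall H A, dfun H -> df A -> df (fun x e => bcode (H x e) (A x e)).
Proof. apply df_fun1. unfold bcode. dsolve. Qed.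
#[export] Hint Resolve df_letters df_bcode : arith_def.

(** * Levels *)

Definition word_count (a n : nat) : nat := prec 1 (fun _ q => S (a * q)) n.

Lemma word_count_spec (a n : nat) : length (words a n) = word_count a n.
Proof.
  induction n as [|n IH]; [reflexivity|]. unfold word_count in *. simpl. rewrite <- IH. f_equal.
  rewrite (flat_map_constant_length (c := length (words a n))).
  - now rewrite length_seq, Nat.mul_comm.
  - intros; apply length_map.
Qed.

(** The size demanded of level [n] starting at [st]. Up to [st] points may be mapped below the level
    by an injection; [word_count (letters n) n * n] is the pigeonhole bound forcing one word to be
    hit more than [n] times; [2 * n] leaves a point outside two exceptional sets of size [n]. *)
Definition req (n st : nat) : nat := S (st + word_count (letters n) n * n + 2 * n).

Definition graph_act (K s v : nat) : nat := beta (csnd K) (s * cfst K + v).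

(** The bound [2 * n + 2] leaves room to compare two words of length at most [n], or a word of
    length at most [2 * n] with a single letter, and it covers single letters at level 0. Words
    enter through their codes, so that the condition is arithmetical. *)
Definition good_graph (n q K : nat) : Prop :=
  q <= cfst K /\
  (forall s v, s < letters n -> v < cfst K ->
     graph_act K s v < cfst K /\ graph_act K s (graph_act K s v) = v) /\
  (forall p v, dl p <> [] -> red (dl p) -> length (dl p) <= 2 * n + 2 ->
     Forall (fun s => s < letters n) (dl p) -> v < cfst K -> run (graph_act K) (dl p) v <> v).

Definition graph_code (n st : nat) : nat := mu (good_graph n (req n st)).

Definition start (n : nat) : nat := prec 0 (fun n st => st + cfst (graph_code n st)) n.

Definition lev (v : nat) : nat := mu (fun n => v < start (S n)).

Definition gam (s v : nat) : nat :=
  ite (s < letters (lev v))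
    (start (lev v) + graph_act (graph_code (lev v) (start (lev v))) s (v - start (lev v))) v.

Lemma good_graph_exists (n q : nat) : exists K, good_graph n q K.
Proof.
  destruct (graph_exists (letters n) (2 * n + 2) q) as (sz & act & H1 & H2 & H3 & H4).
  destruct (beta_spec (fun i => act (i / sz) (i mod sz)) (letters n * sz)) as [c Hc].
  exists (cpair sz c).
  assert (E : forall s v, s < letters n -> v < sz -> graph_act (cpair sz c) s v = act s v).
  { intros s v Hs Hv. unfold graph_act. rewrite cfst_pair, csnd_pair, Hc by nia.
    rewrite Nat.add_comm, Nat.div_add, Nat.Div0.mod_add, Nat.div_small, Nat.mod_small by lia.
    reflexivity. }
  unfold good_graph. rewrite cfst_pair. split; [exact H1|]. split.
  - intros s v Hs Hv. rewrite (E s v Hs Hv), (E s (act s v) Hs (H2 s v Hv)). auto.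
  - intros p v Hp Hr Hl HF Hv.
    assert (Er : run (graph_act (cpair sz c)) (dl p) v = run act (dl p) v /\ run act (dl p) v < sz).
    { clear Hp Hr Hl. induction HF as [|s w Hs _ [IH1 IH2]]; simpl; [auto|].
      fold (run (graph_act (cpair sz c)) w v) (run act w v). rewrite IH1. auto. }
    rewrite (proj1 Er). apply H4; auto.
Qed.

Lemma graph_code_spec (n st : nat) : good_graph n (req n st) (graph_code n st).
Proof. destruct (good_graph_exists n (req n st)) as [K HK]. exact (mu_in _ K HK). Qed.

Lemma start_S (n : nat) : start (S n) = start n + cfst (graph_code n (start n)).
Proof. reflexivity. Qed.

Lemma start_req (n : nat) : start n + req n (start n) <= start (S n).
Proof. rewrite start_S. pose proof (proj1 (graph_code_spec n (start n))). lia. Qed.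

Lemma start_mono (n m : nat) : n <= m -> start n <= start m.
Proof.
  induction 1 as [|m _ IH]; [auto|]. pose proof (start_req m). lia.
Qed.

Lemma start_ge (n : nat) : n <= start n.
Proof. induction n as [|n IH]; [lia|]. pose proof (start_req n). unfold req in *. lia. Qed.

Lemma lev_spec (v : nat) : start (lev v) <= v < start (S (lev v)).
Proof.
  assert (H : v < start (S (lev v))).
  { apply (mu_in (fun n => v < start (S n)) v). pose proof (start_ge (S v)). lia. }
  split; [|exact H]. destruct (lev v) as [|k] eqn:E; [apply Nat.le_0_l|].
  destruct (le_lt_dec (start (S k)) v) as [|Hl]; [assumption|].
  assert (lev v <= k) by (apply (mu_le (fun n => v < start (S n))); exact Hl). lia.
Qed.

Lemma lev_iff (v n : nat) : lev v = n <-> start n <= v < start (S n).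
Proof.
  split; [intros <-; apply lev_spec|]. intros H. pose proof (lev_spec v) as H'.
  destruct (lt_eq_lt_dec (lev v) n) as [[Hl|He]|Hl]; [|exact He|].
  - pose proof (start_mono (S (lev v)) n Hl). lia.
  - pose proof (start_mono (S n) (lev v) Hl). lia.
Qed.

Lemma lev_ge_iff (v n : nat) : n <= lev v <-> start n <= v.
Proof.
  pose proof (lev_spec v). split; intros H'.
  - pose proof (start_mono n (lev v) H'). lia.
  - destruct (le_lt_dec n (lev v)) as [|Hl]; [assumption|].
    pose proof (start_mono (S (lev v)) n Hl). lia.
Qed.

Lemma gam_level (s v : nat) : lev (gam s v) = lev v /\ gam s (gam s v) = v.
Proof.
  set (n := lev v). assert (Hv := lev_spec v). fold n in Hv.
  destruct (classic (s < letters n)) as [Hs|Hs].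
  - destruct (graph_code_spec n (start n)) as (_ & H & _).
    destruct (H s (v - start n) Hs) as [H1 H2]; [rewrite start_S in Hv; lia|].
    assert (E : gam s v = start n + graph_act (graph_code n (start n)) s (v - start n))
      by (unfold gam; fold n; now rewrite ite_true).
    assert (L : lev (gam s v) = n) by (apply lev_iff; rewrite E, start_S; lia).
    split; [exact L|]. unfold gam at 1. rewrite L, ite_true, E by exact Hs.
    replace (start n + graph_act (graph_code n (start n)) s (v - start n) - start n)
      with (graph_act (graph_code n (start n)) s (v - start n)) by lia.
    rewrite H2. lia.
  - assert (E : gam s v = v) by (unfold gam; fold n; now rewrite ite_false).
    now rewrite !E.
Qed.

Lemma gam_free (n : nat) (w : list nat) (v : nat) :
  w <> [] -> red w -> Forall (fun s => s < letters n) w -> length w <= 2 * n + 2 -> lev v = n ->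
  run gam w v <> v.
Proof.
  intros Hne Hr HF Hl Hv. destruct (graph_code_spec n (start n)) as (_ & H1 & H2).
  set (K := graph_code n (start n)) in *.
  assert (Hv' := lev_spec v). rewrite Hv, start_S in Hv'. fold K in Hv'.
  assert (E : run gam w v = start n + run (graph_act K) w (v - start n) /\
              run (graph_act K) w (v - start n) < cfst K).
  { clear Hne Hr Hl. induction HF as [|s w Hs _ [IH1 IH2]]; simpl; [lia|].
    fold (run gam w v) (run (graph_act K) w (v - start n)). rewrite IH1.
    set (u := run (graph_act K) w (v - start n)) in *. split; [|now apply H1].
    assert (L : lev (start n + u) = n) by (apply lev_iff; rewrite start_S; fold K; lia).
    unfold gam. rewrite L, ite_true by exact Hs. fold K. f_equal. f_equal. lia. }
  destruct (dl_surj w) as [p <-]. destruct E as [E _]. rewrite E.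
  intros E'. apply (H2 p (v - start n)); auto; lia.
Qed.

Lemma gam_unique (n : nat) (u w : list nat) (v : nat) :
  red u -> red w -> Forall (fun s => s < letters n) u -> Forall (fun s => s < letters n) w ->
  length u + length w <= 2 * n + 2 -> lev v = n -> run gam u v = run gam w v -> u = w.
Proof.
  apply (red_unique gam (fun s => s < letters n) (fun v => lev v = n)).
  - intros a x _. apply gam_level.
  - intros a x _. now rewrite (proj1 (gam_level a x)).
  - intros w' v'. intros. now apply (gam_free n).
Qed.

Lemma df_word_count : forall A B, df A -> df B -> df (fun x e => word_count (A x e) (B x e)).
Proof. apply df_nat2. unfold word_count. dsolve. Qed.
#[export] Hint Resolve df_word_count : arith_def.

Lemma df_req : forall A B, df A -> df B -> df (fun x e => req (A x e) (B x e)).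
Proof. apply df_nat2. unfold req. dsolve. Qed.

Lemma df_graph_act : forall A B C, df A -> df B -> df C -> df (fun x e => graph_act (A x e) (B x e) (C x e)).
Proof. apply df_nat3. unfold graph_act. dsolve. Qed.
#[export] Hint Resolve df_req df_graph_act : arith_def.

Lemma dp_good_graph : forall A B C, df A -> df B -> df C ->
  dp (fun x e => good_graph (A x e) (B x e) (C x e)).
Proof.
  apply dp_nat3. unfold good_graph.
  apply (dp_iff (fun x e => e 1 <= cfst (e 2) /\
  (forall s v, s < letters (e 0) -> v < cfst (e 2) ->
     graph_act (e 2) s v < cfst (e 2) /\ graph_act (e 2) s (graph_act (e 2) s v) = v) /\
  (forall p v, 0 < csnd p -> red (dl p) -> length (dl p) <= 2 * e 0 + 2 ->
     Forall (fun s => s < letters (e 0)) (dl p) -> v < cfst (e 2) -> run (graph_act (e 2)) (dl p) v <> v))).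
  - intros x e. assert (E : forall p, 0 < csnd p <-> dl p <> []).
    { intros p. unfold dl. destruct (csnd p); simpl; split; intros; try lia; try easy. }
    setoid_rewrite E. reflexivity.
  - dsolve.
Qed.
#[export] Hint Resolve dp_good_graph : arith_def.

Lemma df_graph_code : forall A B, df A -> df B -> df (fun x e => graph_code (A x e) (B x e)).
Proof. apply df_nat2. unfold graph_code. dsolve. Qed.
#[export] Hint Resolve df_graph_code : arith_def.

Lemma df_start : forall A, df A -> df (fun x e => start (A x e)).
Proof. apply df_nat1. unfold start. dsolve. Qed.
#[export] Hint Resolve df_start : arith_def.

Lemma df_lev : forall A, df A -> df (fun x e => lev (A x e)).
Proof. apply df_nat1. unfold lev. dsolve. Qed.
#[export] Hint Resolve df_lev : arith_def.

Lemma df_gam : forall A B, df A -> df B -> df (fun x e => gam (A x e) (B x e)).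
Proof. apply df_nat2. unfold gam. dsolve. Qed.
#[export] Hint Resolve df_gam : arith_def.

(** * Generators *)

Definition ee (x : baire) (v : nat) : nat := gam (bcode x (lev v)) v.

Definition decoded (x : baire) (i : nat) : nat := mu (fun j => x (cpair i j) = 1).

(** The levels reserved for [x] are codes of its initial segments. Two distinct sequences share only
    finitely many, so that eventually at most one of finitely many given generators is modified from
    a given level. *)
Definition own (x : baire) (n : nat) : Prop := exists k, n = cpair k (bcode x k).

(** For [n <= n']: the binary word coded by [s'] extends the one coded by [s]. With both pairs equal
    it says that [s] codes a binary word of length [n]. *)
Definition prefix_letter (n s n' s' : nat) : Prop :=
  exists V, (forall k, k < n' -> beta V k < 2) /\ bcode (beta V) n = s /\ bcode (beta V) n' = s'.

Definition code_word (n p : nat) : Prop :=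
  red (dl p) /\ length (dl p) <= n /\ Forall (fun s => prefix_letter n s n s) (dl p).

(** The condition [start n <= h m] keeps a modification made for level [n] from reaching lower
    levels. *)
Definition far (h : baire) (n m : nat) : Prop :=
  lev m = n /\ start n <= h m /\ forall p, code_word n p -> run gam (dl p) m <> h m.

(** This expresses more than [n] agreements without counting. The surplus later absorbs the points
    where [dot] and [ee] differ. *)
Definition popular (h : baire) (n p : nat) : Prop :=
  code_word n p /\
  forall z, length (dl z) <= n ->
    exists v, lev v = n /\ run gam (dl p) v = h v /\ ~ In v (dl z).

Definition has_popular (h : baire) (n : nat) : Prop :=
  (forall m, ~ far h n m) /\ exists p, popular h n p.

Definition popular_word (h : baire) (n : nat) : nat := mu (popular h n).

Definition is_site (h : baire) (n m : nat) : Prop :=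
  far h n m \/ (has_popular h n /\ lev m = n /\ run gam (dl (popular_word h n)) m = h m).

Definition site (h : baire) (n : nat) : nat := mu (is_site h n).

Definition cand (x : baire) (n : nat) : Prop := own x n /\ exists m, is_site (decoded x) n m.

Definition coherent (h : baire) (n n' : nat) : Prop :=
  n < n' /\ has_popular h n /\ has_popular h n' /\
  csnd (popular_word h n) = csnd (popular_word h n') /\
  forall i, i < csnd (popular_word h n) ->
    prefix_letter n (el (popular_word h n) i) n' (el (popular_word h n') i).

Definition fertile (x : baire) (n : nat) : Prop :=
  forall N, exists n', N < n' /\ cand x n' /\ coherent (decoded x) n n'.

Definition lower (x : baire) (n : nat) : nat := site (decoded x) n.
Definition upper (x : baire) (n : nat) : nat := decoded x (lower x n).

(** The last two conditions say that the two edges to be replaced are distinct. On infertile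
    candidates they fail only finitely often, by [barren_not_joined] for the words [[]] and
    [[x]]. *)
Definition admissible (x : baire) (n : nat) : Prop :=
  cand x n /\ ~ fertile x n /\ upper x n <> lower x n /\ upper x n <> ee x (lower x n).

(* All admissible levels below [n] that were selected involve levels below [used x n] only. *)
Definition used (x : baire) (n : nat) : nat :=
  prec 0 (fun n b => ite (admissible x n /\ b <= n) (S (lev (upper x n))) b) n.

Definition cut (x : baire) (n : nat) : Prop := admissible x n /\ used x n <= n.

Definition swapped (x : baire) (n v y : nat) : Prop :=
  cut x n /\
  ((v = lower x n /\ y = upper x n) \/ (v = upper x n /\ y = lower x n) \/
   (v = ee x (lower x n) /\ y = ee x (upper x n)) \/ (v = ee x (upper x n) /\ y = ee x (lower x n))).

Definition touched (x : baire) (n v : nat) : Prop := exists y, swapped x n v y.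

Definition dot (x : baire) (v : nat) : nat :=
  mu (fun y => (exists n, swapped x n v y) \/ ((forall n, ~ touched x n v) /\ y = ee x v)).

(** * Arithmetical definability of the generators *)

Lemma df_ee : forall H A, dfun H -> df A -> df (fun x e => ee (H x e) (A x e)).
Proof. apply df_fun1. unfold ee. dsolve. Qed.

Lemma df_decoded : forall H A, dfun H -> df A -> df (fun x e => decoded (H x e) (A x e)).
Proof. apply df_fun1. unfold decoded. dsolve. Qed.

Lemma dp_own : forall H A, dfun H -> df A -> dp (fun x e => own (H x e) (A x e)).
Proof. apply dp_rel1. unfold own. dsolve. Qed.
#[export] Hint Resolve df_ee df_decoded dp_own : arith_def.

Lemma dp_prefix_letter (A B C D : baire -> env -> nat) :
  df A -> df B -> df C -> df D -> dp (fun x e => prefix_letter (A x e) (B x e) (C x e) (D x e)).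
Proof.
  intros HA HB HC HD.
  assert (H : dp (fun x e => prefix_letter (e 0) (e 1) (e 2) (e 3))) by (unfold prefix_letter; dsolve).
  exact (dp_app _ (fun x e => x) (tcons A (tcons B (tcons C (tup1 D)))) H dfun_id
    (df_tcons _ _ HA (df_tcons _ _ HB (df_tcons _ _ HC (fun _ => HD))))).
Qed.
#[export] Hint Resolve dp_prefix_letter : arith_def.

Lemma dp_code_word : forall A B, df A -> df B -> dp (fun x e => code_word (A x e) (B x e)).
Proof. apply dp_nat2. unfold code_word. dsolve. Qed.
#[export] Hint Resolve dp_code_word : arith_def.

Lemma dp_far : forall H A B, dfun H -> df A -> df B -> dp (fun x e => far (H x e) (A x e) (B x e)).
Proof. apply dp_rel2. unfold far. dsolve. Qed.

Lemma dp_popular : forall H A B, dfun H -> df A -> df B -> dp (fun x e => popular (H x e) (A x e) (B x e)).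
Proof. apply dp_rel2. unfold popular. dsolve. Qed.
#[export] Hint Resolve dp_far dp_popular : arith_def.

Lemma dp_has_popular : forall H A, dfun H -> df A -> dp (fun x e => has_popular (H x e) (A x e)).
Proof. apply dp_rel1. unfold has_popular. dsolve. Qed.

Lemma df_popular_word : forall H A, dfun H -> df A -> df (fun x e => popular_word (H x e) (A x e)).
Proof. apply df_fun1. unfold popular_word. dsolve. Qed.
#[export] Hint Resolve dp_has_popular df_popular_word : arith_def.

Lemma dp_is_site : forall H A B, dfun H -> df A -> df B -> dp (fun x e => is_site (H x e) (A x e) (B x e)).
Proof. apply dp_rel2. unfold is_site. dsolve. Qed.
#[export] Hint Resolve dp_is_site : arith_def.

Lemma df_site : forall H A, dfun H -> df A -> df (fun x e => site (H x e) (A x e)).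
Proof. apply df_fun1. unfold site. dsolve. Qed.

Lemma dp_cand : forall H A, dfun H -> df A -> dp (fun x e => cand (H x e) (A x e)).
Proof. apply dp_rel1. unfold cand. dsolve. Qed.

Lemma dp_coherent : forall H A B, dfun H -> df A -> df B -> dp (fun x e => coherent (H x e) (A x e) (B x e)).
Proof. apply dp_rel2. unfold coherent. dsolve. Qed.
#[export] Hint Resolve df_site dp_cand dp_coherent : arith_def.

Lemma df_lower : forall H A, dfun H -> df A -> df (fun x e => lower (H x e) (A x e)).
Proof. apply df_fun1. unfold lower. dsolve. Qed.
#[export] Hint Resolve df_lower : arith_def.

Lemma df_upper : forall H A, dfun H -> df A -> df (fun x e => upper (H x e) (A x e)).
Proof. apply df_fun1. unfold upper. dsolve. Qed.
#[export] Hint Resolve df_upper : arith_def.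

Lemma dp_admissible : forall H A, dfun H -> df A -> dp (fun x e => admissible (H x e) (A x e)).
Proof. apply dp_rel1. unfold admissible, fertile. dsolve. Qed.
#[export] Hint Resolve dp_admissible : arith_def.

Lemma df_used : forall H A, dfun H -> df A -> df (fun x e => used (H x e) (A x e)).
Proof. apply df_fun1. unfold used. dsolve. Qed.
#[export] Hint Resolve df_used : arith_def.

Lemma df_dot : forall H A, dfun H -> df A -> df (fun x e => dot (H x e) (A x e)).
Proof. apply df_fun1. unfold dot, touched, swapped, cut. dsolve. Qed.
#[export] Hint Resolve df_dot : arith_def.

(** * Basic properties of the generators *)

Lemma ee_level (x : baire) (v : nat) : lev (ee x v) = lev v.
Proof. apply gam_level. Qed.

Lemma ee_ee (x : baire) (v : nat) : ee x (ee x v) = v.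
Proof. unfold ee at 1. rewrite ee_level. apply gam_level. Qed.

Lemma ee_neq (x : baire) (v : nat) : bits x -> ee x v <> v.
Proof.
  intros Hx. apply (gam_free (lev v) [bcode x (lev v)]); simpl; try easy; try lia.
  constructor; [|constructor]. apply bcode_lt. auto.
Qed.

Lemma run_ee (w : list baire) (v : nat) :
  run ee w v = run gam (map (fun x => bcode x (lev v)) w) v /\ lev (run ee w v) = lev v.
Proof.
  induction w as [|x w [IH1 IH2]]; simpl; [auto|].
  fold (run ee w v) (run gam (map (fun x => bcode x (lev v)) w) v). rewrite ee_level.
  split; [|exact IH2]. unfold ee at 1. now rewrite IH2, IH1.
Qed.

Lemma is_site_level (h : baire) (n m : nat) : is_site h n m -> lev m = n /\ n <= lev (h m).
Proof.
  intros [(H1 & H2 & _)|(_ & H1 & H2)]; split; auto.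
  - now apply lev_ge_iff.
  - rewrite <- H2, <- H1. generalize (dl (popular_word h (lev m))) as w.
    induction w as [|s w IH]; simpl; [auto|]. now rewrite (proj1 (gam_level _ _)).
Qed.

Lemma cut_site (x : baire) (n : nat) : cut x n -> is_site (decoded x) n (lower x n).
Proof. intros [[[_ [m Hm]] _] _]. exact (mu_in _ m Hm). Qed.

Lemma cut_level (x : baire) (n : nat) : cut x n -> lev (lower x n) = n /\ n <= lev (upper x n).
Proof. intros H. exact (is_site_level _ _ _ (cut_site x n H)). Qed.

Lemma used_cut (x : baire) (n : nat) : cut x n -> used x (S n) = S (lev (upper x n)).
Proof. intros H. unfold used. simpl. apply ite_true. exact H. Qed.

Lemma used_mono (x : baire) (n m : nat) : n <= m -> used x n <= used x m.
Proof.
  induction 1 as [|m _ IH]; [auto|].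
  destruct (classic (cut x m)) as [H|H].
  - rewrite used_cut by exact H. destruct (cut_level x m H). destruct H. lia.
  - unfold used. simpl. rewrite ite_false by exact H. exact IH.
Qed.

Lemma cut_separated (x : baire) (n n' : nat) : cut x n -> cut x n' -> n < n' -> lev (upper x n) < n'.
Proof.
  intros H H' Hl. pose proof (used_mono x (S n) n' Hl) as E. rewrite used_cut in E by exact H.
  destruct H'. lia.
Qed.

Lemma swapped_level (x : baire) (n v y : nat) :
  swapped x n v y -> cut x n /\ n <= lev v /\ (lev v = n \/ lev v = lev (upper x n)).
Proof.
  intros [Hc H]. destruct (cut_level x n Hc) as [H1 H2]. split; [exact Hc|].
  destruct H as [[-> _]|[[-> _]|[[-> _]|[-> _]]]]; rewrite ?ee_level; lia.
Qed.

Lemma touched_unique (x : baire) (n n' v : nat) : touched x n v -> touched x n' v -> n = n'.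
Proof.
  intros [y H] [y' H']. apply swapped_level in H, H'.
  destruct H as (Hc & H1 & H2), H' as (Hc' & H1' & H2').
  destruct (cut_level x n Hc) as [_ L]. destruct (cut_level x n' Hc') as [_ L'].
  destruct (lt_eq_lt_dec n n') as [[Hl|He]|Hl]; [|exact He|].
  - pose proof (cut_separated x n n' Hc Hc' Hl). lia.
  - pose proof (cut_separated x n' n Hc' Hc Hl). lia.
Qed.

(** The four ends of the two edges are distinct: [ee x] has no fixed points, and admissibility
    excludes the remaining coincidences. *)
Lemma swapped_unique (x : baire) (n v y y' : nat) :
  bits x -> swapped x n v y -> swapped x n v y' -> y = y'.
Proof.
  intros Hx [Hc H] [_ H']. destruct Hc as [[_ [_ [Hne Hne']]] _].
  set (m := lower x n) in *. set (c := upper x n) in *.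
  assert (N1 := ee_neq x m Hx). assert (N2 := ee_neq x c Hx).
  assert (N3 : ee x c <> m) by (intros E; apply Hne'; now rewrite <- E, ee_ee).
  assert (N4 : ee x c <> ee x m) by (intros E; apply Hne; now rewrite <- (ee_ee x c), E, ee_ee).
  intuition congruence.
Qed.

Lemma dot_swapped (x : baire) (n v y : nat) : bits x -> swapped x n v y -> dot x v = y.
Proof.
  intros Hx H. apply mu_eq; [left; now exists n|].
  intros y' [[n' H']|[H' _]].
  - assert (n' = n) as -> by (apply (touched_unique x n' n v); eexists; eassumption).
    now apply (swapped_unique x n v).
  - exfalso. apply (H' n). now exists y.
Qed.

Lemma dot_untouched (x : baire) (v : nat) : (forall n, ~ touched x n v) -> dot x v = ee x v.
Proof.
  intros H. apply mu_eq; [now right|]. intros y [[n H']|[_ H']]; [|exact H'].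
  exfalso. apply (H n). now exists y.
Qed.

Lemma swapped_sym (x : baire) (n v y : nat) : swapped x n v y -> swapped x n y v.
Proof. unfold swapped. tauto. Qed.

Lemma swapped_ee (x : baire) (n v y : nat) : swapped x n v y -> swapped x n (ee x v) (ee x y).
Proof. intros [Hc [[-> ->]|[[-> ->]|[[-> ->]|[-> ->]]]]]; split; auto; rewrite ?ee_ee; tauto. Qed.

Lemma dot_dot (x : baire) (v : nat) : bits x -> dot x (dot x v) = v.
Proof.
  intros Hx. destruct (classic (exists n, touched x n v)) as [[n [y H]]|H].
  - rewrite (dot_swapped x n v y Hx H). apply (dot_swapped x n); auto using swapped_sym.
  - rewrite (dot_untouched x v) by eauto. rewrite dot_untouched; [apply ee_ee|].
    intros n [y Hy]. apply H. exists n, (ee x y). rewrite <- (ee_ee x v). now apply swapped_ee.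
Qed.

(** * The generated group is cofinitary *)

Lemma finite_bound {T : Type} (l : list T) (Q : T -> nat -> Prop) :
  (forall t, In t l -> exists N, forall n, N <= n -> Q t n) ->
  exists N, forall t n, In t l -> N <= n -> Q t n.
Proof.
  induction l as [|a l IH]; intros H; [exists 0; intros t n []|].
  destruct IH as [N1 H1]; [intros t Ht; apply H; now right|].
  destruct (H a) as [N2 H2]; [now left|].
  exists (N1 + N2). intros t n [<-|Ht] Hn; [apply H2 | apply H1; [exact Ht|]]; lia.
Qed.

Lemma letters_distinct (l : list baire) : Forall bits l ->
  exists N, forall x y n, In x l -> In y l -> N <= n -> bcode x n = bcode y n -> x = y.
Proof.
  intros Hl. rewrite Forall_forall in Hl.
  destruct (finite_bound (list_prod l l) (fun xy n => bcode (fst xy) n = bcode (snd xy) n -> fst xy = snd xy))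
    as [N HN].
  - intros [x y] Hxy. apply in_prod_iff in Hxy. destruct Hxy as [Hx Hy]. simpl.
    destruct (classic (x = y)) as [E|E]; [exists 0; auto|].
    destruct (bits_distinct x y) as [N HN]; auto. exists N. intros n Hn E'. now apply HN in E'.
  - exists N. intros x y n Hx Hy Hn. apply (HN (x, y)); [now apply in_prod_iff | exact Hn].
Qed.

Lemma own_distinct (l : list baire) : Forall bits l ->
  exists N, forall x y n, In x l -> In y l -> N <= n -> own x n -> own y n -> x = y.
Proof.
  intros Hl. rewrite Forall_forall in Hl.
  destruct (finite_bound (list_prod l l) (fun xy n => own (fst xy) n -> own (snd xy) n -> fst xy = snd xy))
    as [N HN].
  - intros [x y] Hxy. apply in_prod_iff in Hxy. destruct Hxy as [Hx Hy]. simpl.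
    destruct (classic (x = y)) as [E|E]; [exists 0; auto|].
    destruct (bits_distinct x y) as [N HN]; auto.
    destruct (bounded_below (fun k => cpair k (bcode x k)) N) as [B HB].
    exists B. intros n Hn [k E1] [k' E2]. exfalso. rewrite E1 in E2. apply cpair_inj in E2.
    destruct E2 as [<- E2]. destruct (le_lt_dec N k) as [Hk|Hk]; [exact (HN k Hk E2)|].
    specialize (HB k Hk). simpl in HB. lia.
  - exists N. intros x y n Hx Hy Hn. apply (HN (x, y)); [now apply in_prod_iff | exact Hn].
Qed.

Lemma prefix_letter_bcode (x : baire) (n n' : nat) :
  bits x -> n <= n' -> prefix_letter n (bcode x n) n' (bcode x n').
Proof.
  intros Hx Hn. destruct (beta_spec x n') as [V HV]. exists V. repeat split.
  - intros k Hk. rewrite HV by exact Hk. apply Hx.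
  - apply bcode_ext. intros k Hk. apply HV. lia.
  - apply bcode_ext. intros k Hk. now apply HV.
Qed.

Lemma prefix_letter_lt (n s n' s' : nat) : prefix_letter n s n' s' -> s' < letters n'.
Proof. intros (V & H1 & _ & <-). now apply bcode_lt. Qed.

Lemma code_word_letters (n p : nat) : code_word n p -> Forall (fun s => s < letters n) (dl p).
Proof.
  intros (_ & _ & H). eapply Forall_impl; [|exact H]. intros s. apply prefix_letter_lt.
Qed.

Lemma bcode_letters (w : list baire) (n : nat) :
  Forall bits w -> Forall (fun s => s < letters n) (map (fun x => bcode x n) w).
Proof.
  intros H. apply Forall_map. eapply Forall_impl; [|exact H]. intros x Hx. apply bcode_lt. auto.
Qed.

Lemma popular_word_spec (h : baire) (n : nat) : has_popular h n -> popular h n (popular_word h n).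
Proof. intros [_ [p Hp]]. exact (mu_in _ p Hp). Qed.

Lemma popular_words_coherent (h : baire) (w : list baire) (n n' : nat) :
  Forall bits w -> n < n' -> has_popular h n -> has_popular h n' ->
  dl (popular_word h n) = map (fun x => bcode x n) w ->
  dl (popular_word h n') = map (fun x => bcode x n') w -> coherent h n n'.
Proof.
  intros Hw Hn H H' E E'. destruct (mk_surj (fun _ => 0) w) as [f Ef].
  assert (L : csnd (popular_word h n) = length w) by (rewrite <- length_dl, E; apply length_map).
  assert (L' : csnd (popular_word h n') = length w) by (rewrite <- length_dl, E'; apply length_map).
  split; [exact Hn|]. split; [exact H|]. split; [exact H'|]. split; [congruence|].
  intros i Hi. rewrite Ef, map_mk in E, E'. unfold dl in E, E'. rewrite ?L, ?L' in *.
  rewrite (mk_inj _ _ _ i E Hi), (mk_inj _ _ _ i E' Hi).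
  apply prefix_letter_bcode; [|lia]. rewrite Ef in Hw. rewrite Forall_mk in Hw. auto.
Qed.

(* If a fixed word connected the two ends infinitely often, then the popular words at these levels
   would be its codes, hence mutually coherent, and these levels would be fertile. *)
Lemma barren_not_joined (x : baire) (w : list baire) :
  Forall bits w -> red w ->
  exists N, forall n, N <= n -> cand x n -> ~ fertile x n -> run ee w (lower x n) <> upper x n.
Proof.
  intros Hw Hr. destruct (letters_distinct w Hw) as [N1 HN1].
  set (h := decoded x).
  assert (Key : forall n, N1 + length w <= n -> cand x n -> run ee w (lower x n) = upper x n ->
            has_popular h n /\ dl (popular_word h n) = map (fun x => bcode x n) w).
  { intros n Hn [_ [m Hm]] E. assert (Hsite : is_site h n (lower x n)) by exact (mu_in _ m Hm).
    assert (L := proj1 (is_site_level _ _ _ Hsite)).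
    rewrite (proj1 (run_ee w (lower x n))), L in E.
    assert (Hred : red (map (fun x => bcode x n) w)).
    { apply red_map; [|exact Hr]. intros a b Ha Hb. apply HN1; auto; lia. }
    destruct Hsite as [(_ & _ & Hf)|(Hp & _ & E')].
    - exfalso. destruct (dl_surj (map (fun x => bcode x n) w)) as [p Ep]. apply (Hf p).
      + unfold code_word. rewrite Ep. split; [exact Hred|]. split; [rewrite length_map; lia|].
        apply Forall_map. eapply Forall_impl; [|exact Hw]. intros a Ha.
        now apply prefix_letter_bcode.
      + rewrite Ep. exact E.
    - split; [exact Hp|]. destruct (popular_word_spec h n Hp) as [Hcw _].
      apply (gam_unique n _ _ (lower x n)).
      + apply Hcw.
      + exact Hred.
      + now apply code_word_letters.
      + now apply bcode_letters.
      + destruct Hcw as (_ & Hl & _). rewrite length_map. lia.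
      + exact L.
      + fold h in E'. rewrite E'. symmetry. exact E. }
  apply NNPP. intros Hno.
  assert (Hinf : forall N, exists n, N <= n /\ cand x n /\ ~ fertile x n /\ run ee w (lower x n) = upper x n).
  { intros N. apply NNPP. intros Hn. apply Hno. exists N. intros n H1 H2 H3 H4. apply Hn. eauto. }
  destruct (Hinf (N1 + length w)) as (n & H1 & H2 & Hnf & H3).
  destruct (Key n H1 H2 H3) as [P E].
  apply Hnf. intros N.
  destruct (Hinf (S (N + n))) as (n' & H1' & H2' & _ & H3').
  destruct (Key n' ltac:(lia) H2' H3') as [P' E']. exists n'. split; [lia|].
  split; [exact H2'|]. apply popular_words_coherent with w; auto; lia.
Qed.

(** * Absence of short cycles *)

(** The bound [k + 2] allows a path of length [k] to be prolonged by one edge at either end, from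
    [ee y (lower y n)] to [lower y n] and from [ee y (upper y n)] to [upper y n]. The bound
    [k <= 2 * N] brings words of length [k] within reach of [gam_unique]. *)
Definition separated (l : list baire) (k N : nat) : Prop :=
  (forall x y n, In x l -> In y l -> N <= n -> bcode x n = bcode y n -> x = y) /\
  (forall x y n, In x l -> In y l -> N <= n -> own x n -> own y n -> x = y) /\
  (forall x n w, In x l -> N <= n -> cut x n -> incl w l -> length w <= k + 2 ->
     run ee w (lower x n) <> upper x n) /\
  k <= 2 * N.

Lemma separated_exists (l : list baire) (k : nat) : Forall bits l -> exists N, separated l k N.
Proof.
  intros Hl. destruct (letters_distinct l Hl) as [N1 H1]. destruct (own_distinct l Hl) as [N2 H2].
  destruct (finite_bound (list_prod l (flat_map (fun j => tuples j l) (seq 0 (k + 3))))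
    (fun xw n => red (snd xw) -> cut (fst xw) n -> run ee (snd xw) (lower (fst xw) n) <> upper (fst xw) n))
    as [N3 H3].
  - intros [x w] Hxw. apply in_prod_iff in Hxw. destruct Hxw as [Hx Hw]. simpl.
    apply in_flat_map in Hw. destruct Hw as (j & _ & Hw). apply in_tuples in Hw.
    destruct (classic (red w)) as [Hr|Hr]; [|exists 0; tauto].
    destruct (barren_not_joined x w) as [N HN]; [|exact Hr|exists N; intros n Hn _ [(Hc & Hf & _) _]; auto].
    apply Forall_forall. intros a Ha. rewrite Forall_forall in Hl. now apply Hl, Hw.
  - exists (N1 + N2 + N3 + k). split; [|split; [|split; [|lia]]].
    + intros x y n Hx Hy Hn. apply H1; auto; lia.
    + intros x y n Hx Hy Hn. apply H2; auto; lia.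
    + intros x n w Hx Hn Hc Hw Hlen.
      (* [barren_not_joined] concerns reduced words; reducing [w] introduces no new letters and no
         additional length. *)
      destruct (reduce ee (fun _ => True) w) as (w' & R1 & R2 & R3 & R4).
      * intros a u _. apply ee_ee.
      * now apply Forall_forall.
      * rewrite <- R4. apply (H3 (x, w') n); auto; [|lia].
        apply in_prod_iff. split; [exact Hx|]. apply in_flat_map. exists (length w').
        split; [apply in_seq; lia|]. apply in_tuples. split; [reflexivity|].
        eapply incl_tran; eassumption.
Qed.

(** The path from [p] that reads [w] from the right crosses an exceptional edge belonging to a
    modification made for level [n]. *)
Definition uses (w : list baire) (p n : nat) : Prop :=
  exists w2 y w1, w = w2 ++ y :: w1 /\ touched y n (run dot w1 p).

Lemma uses_first (w : list baire) (p n : nat) : uses w p n ->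
  exists w2 y w1, w = w2 ++ y :: w1 /\ touched y n (run dot w1 p) /\ ~ uses w1 p n.
Proof.
  induction w as [|a w IH]; intros (w2 & y & w1 & E & H); [destruct w2; discriminate|].
  destruct (classic (uses w p n)) as [Hu|Hu].
  - destruct (IH Hu) as (v2 & z & v1 & -> & H1 & H2). exists (a :: v2), z, v1. auto.
  - destruct w2 as [|b w2]; simpl in E; injection E as -> ->.
    + exists [], y, w1. auto.
    + exfalso. apply Hu. exists w2, y, w1. auto.
Qed.

Lemma uses_suffix (w w' : list baire) (p n : nat) : uses w p n -> uses (w' ++ w) p n.
Proof.
  intros (w2 & y & w1 & -> & H). exists (w' ++ w2), y, w1. rewrite <- app_assoc. auto.
Qed.

Lemma uses_prefix (w w' : list baire) (p n : nat) : uses w' (run dot w p) n -> uses (w' ++ w) p n.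
Proof.
  intros (w2 & y & w1 & -> & H). exists w2, y, (w1 ++ w). rewrite <- app_assoc, run_app. auto.
Qed.

Lemma dot_touched (x : baire) (n v : nat) : bits x -> touched x n v -> swapped x n v (dot x v).
Proof. intros Hx [y H]. now rewrite (dot_swapped x n v y Hx H). Qed.

(** Both ends of an exceptional edge made for level [i] lie on levels at least [i], and all other
    edges preserve levels. If every such [i] exceeds [n], a path can neither enter nor leave level
    [n]. *)
Lemma uses_none_level (w : list baire) (p n : nat) :
  Forall bits w -> (forall i, uses w p i -> n < i) -> lev p = n \/ lev (run dot w p) = n ->
  lev p = n /\ lev (run dot w p) = n /\ run dot w p = run ee w p.
Proof.
  induction w as [|y w IH]; intros Hb Hu Hlev; simpl in *; [tauto|].
  fold (run dot w p) (run ee w p) in *. inversion Hb as [|? ? Hy Hb']; subst.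
  assert (Hu' : forall i, uses w p i -> n < i) by (intros i Hi; apply Hu; now apply (uses_suffix w [y])).
  destruct (classic (exists i, touched y i (run dot w p))) as [[i Hi]|Hno].
  - exfalso. assert (Hni : n < i) by (apply Hu; exists [], y, w; auto).
    pose proof (dot_touched y i _ Hy Hi) as Hs.
    pose proof (swapped_level _ _ _ _ Hs) as (_ & L1 & _).
    apply swapped_sym in Hs. pose proof (swapped_level _ _ _ _ Hs) as (_ & L2 & _).
    destruct Hlev as [Hl|Hl]; [|lia].
    destruct (IH Hb' Hu' (or_introl Hl)) as (_ & L3 & _). lia.
  - rewrite (dot_untouched y (run dot w p)) in * by eauto. rewrite ee_level in *.
    destruct (IH Hb' Hu' Hlev) as (A & B & C). rewrite C in *. auto.
Qed.

(** Adding at most one edge of [ee y] at either end turns the path into one from [lower y n] to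
    [upper y n] of length at most [k + 2]. *)
Lemma swapped_not_joined (l : list baire) (k N : nat) (y : baire) (n a b : nat) (z : list baire) :
  separated l k N -> In y l -> N <= n -> cut y n ->
  (a = lower y n \/ a = ee y (lower y n)) -> (b = upper y n \/ b = ee y (upper y n)) ->
  incl z l -> length z <= k -> b = run ee z a \/ a = run ee z b -> False.
Proof.
  intros (_ & _ & H3 & _) Hy Hn Hc Ha Hb Hz Hk Hor.
  assert (Hz' : exists z, incl z l /\ length z <= k /\ b = run ee z a).
  { destruct Hor as [E|E]; [exists z; auto|]. exists (rev z). rewrite length_rev. split.
    - intros t Ht. apply Hz. now apply in_rev.
    - split; [exact Hk|]. rewrite E. symmetry. apply (run_rev ee (fun _ => True)).
      + intros; apply ee_ee.
      + now apply Forall_forall. }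
  clear z Hz Hk Hor. destruct Hz' as (z & Hz & Hk & E).
  assert (Ha' : exists z1, incl z1 l /\ length z1 <= 1 /\ a = run ee z1 (lower y n)).
  { destruct Ha as [->| ->]; [exists [] | exists [y]]; simpl; repeat split; auto using incl_nil_l.
    intros t [<-|[]]; exact Hy. }
  assert (Hb' : exists z2, incl z2 l /\ length z2 <= 1 /\ upper y n = run ee z2 b).
  { destruct Hb as [->| ->]; [exists [] | exists [y]]; simpl; repeat split; auto using incl_nil_l.
    - intros t [<-|[]]; exact Hy.
    - now rewrite ee_ee. }
  destruct Ha' as (z1 & I1 & L1 & E1), Hb' as (z2 & I2 & L2 & E2).
  apply (H3 y n (z2 ++ z ++ z1)); auto.
  - auto using incl_app.
  - rewrite !length_app. lia.
  - now rewrite !run_app, <- E1, <- E, <- E2.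
Qed.

(* For the induction one must also exclude that the path joins the two ends of an edge [p], [ee y p]
   that [dot y] has removed.  Among the exceptional edges that are met, those of the lowest level [n]
   are crossed at most once, since no other exceptional edge leads back to level [n]; and a single
   crossing yields a short path joining both sides inside level [n]. *)
Lemma no_short_cycle (l : list baire) (k N0 N : nat) :
  Forall bits l -> separated l k N0 -> N0 <= N ->
  (forall x n v, In x l -> touched x n v -> N <= lev v -> N0 <= n) ->
  forall w p, w <> [] -> red w -> incl w l -> length w <= k ->
    (forall w1 w2, w = w1 ++ w2 -> N <= lev (run dot w2 p)) ->
    run dot w p <> p /\ forall y n, In y l -> touched y n p -> run dot w p <> ee y p.
Proof.
  intros Hl Hsep HN Htouch w. pose proof Hsep as (S1 & S2 & S3 & S4).
  assert (Hbits : forall z, In z l -> bits z) by (now apply Forall_forall).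
  assert (Hsub : forall w : list baire, incl w l -> Forall bits w).
  { intros w' H. apply Forall_forall. auto. }
  induction w as [w IH] using (well_founded_induction (well_founded_ltof _ (@length baire))).
  unfold ltof in IH. intros p Hne Hr Hincl Hk Hlev. set (q := run dot w p).
  (* Both claims at once: [ys] is empty for a closed path and [[y]] for a path joining the ends of a
     removed edge. *)
  assert (Goal' : forall ys, incl ys l -> length ys <= 1 ->
             (forall y, In y ys -> exists n, touched y n p) -> q = run ee ys p -> False).
  2:{ split.
      - intros E. apply (Goal' []); auto using incl_nil_l. intros y [].
      - intros y n Hy Ht E. apply (Goal' [y]); auto.
        + intros t [<-|[]]; exact Hy.
        + intros t [<-|[]]; eauto. }
  intros ys Hys Hlys Htys Eq.
  assert (Lq : lev q = lev p) by (rewrite Eq; apply run_ee).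
  assert (Lp : N <= lev p) by (apply (Hlev w []); now rewrite app_nil_r).
  destruct (classic (exists n, uses w p n)) as [[n0 Hn0]|Hno].
  (* Without exceptional edges everything happens in one level, and uniqueness of short words gives
     [w = ys]. As [w] is nonempty, it is a single letter that crosses an exceptional edge at [p]
     after all. *)
  2:{ destruct (uses_none_level w p (lev p)) as (_ & _ & E); auto.
      { intros i Hi. exfalso. eauto. }
      fold q in E. rewrite E in Eq. set (n := lev p) in *.
      rewrite (proj1 (run_ee w p)), (proj1 (run_ee ys p)) in Eq.
      assert (Hred : forall l' : list baire, incl l' l -> red l' -> red (map (fun x => bcode x n) l')).
      { intros l' Hi Hr'. apply red_map; [|exact Hr']. intros a b Ha Hb. apply S1; auto; lia. }
      apply (gam_unique n) in Eq; auto.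
      - destruct ys as [|y [|]]; simpl in *; [|clear Hlys|lia].
        + apply Hne. now apply map_eq_nil in Eq.
        + destruct w as [|a [|]]; try discriminate. injection Eq as Eq.
          assert (a = y) as -> by (apply (S1 a y n); [apply Hincl | apply Hys | lia |]; simpl; auto).
          destruct (Htys y (or_introl eq_refl)) as [i Hi].
          apply Hno. exists i, [], y, []. auto.
      - apply Hred; auto. destruct ys as [|y [|]]; simpl in *; [auto| |lia]. split; [discriminate | auto].
      - now apply bcode_letters, Hsub.
      - now apply bcode_letters, Hsub.
      - rewrite !length_map. lia. }
  destruct (least_exists _ n0 Hn0) as (n & Hn & Hmin). clear n0 Hn0.
  destruct (uses_first w p n Hn) as (w2 & y & w1 & Ew & Htu & Hu1).
  assert (Hy : In y l) by (apply Hincl; rewrite Ew; apply in_elt).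
  set (u := run dot w1 p) in *. set (u' := dot y u).
  assert (Hsw : swapped y n u u') by (apply dot_touched; auto).
  pose proof (swapped_level _ _ _ _ Hsw) as (Hc & _). pose proof (cut_level y n Hc) as [Lm Lc].
  assert (Lu : N <= lev u) by (apply (Hlev (w2 ++ [y]) w1); now rewrite <- app_assoc).
  assert (HN0 : N0 <= n) by (apply (Htouch y n u); auto).
  assert (Q2 : q = run dot w2 u') by (unfold q; rewrite Ew, run_app; reflexivity).
  assert (I1 : incl w1 l).
  { intros t Ht. apply Hincl. rewrite Ew. apply in_or_app. right. now right. }
  assert (I2 : incl w2 l).
  { intros t Ht. apply Hincl. rewrite Ew. apply in_or_app. now left. }
  assert (U1 : forall i, uses w1 p i -> n < i).
  { intros i Hi. assert (n <= i).
    { apply Hmin. rewrite Ew. replace (w2 ++ y :: w1) with ((w2 ++ [y]) ++ w1)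
        by (now rewrite <- app_assoc). now apply uses_suffix. }
    assert (i <> n) by (intros ->; auto). lia. }
  assert (Hsuf : forall w4 w3 i, w2 = w4 ++ w3 -> uses w3 u' i -> n <= i).
  { intros w4 w3 i E Hi. apply Hmin. rewrite Ew, E, <- app_assoc. apply uses_suffix.
    now apply uses_prefix. }
  destruct (classic (uses w2 u' n)) as [Hu2|Hu2].
  - destruct (uses_first w2 u' n Hu2) as (w4 & y' & w3 & Ew2 & Htt & Hu3).
    assert (Hy' : In y' l) by (apply I2; rewrite Ew2; apply in_elt).
    set (t := run dot w3 u') in *.
    assert (Hc' : cut y' n) by (destruct Htt as [t' Ht']; apply swapped_level in Ht'; apply Ht').
    (* A second crossing for the same level belongs to the same generator, because only one of them
       owns this level. *)
    assert (y' = y) as -> by (apply (S2 y' y n); auto; [apply Hc' | apply Hc]).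
    assert (U3 : forall i, uses w3 u' i -> n < i).
    { intros i Hi. assert (n <= i).
      { apply (Hsuf (w4 ++ [y]) w3); [now rewrite <- app_assoc | exact Hi]. }
      assert (i <> n) by (intros ->; auto). lia. }
    assert (I3 : incl w3 l).
    { intros s Hs. apply I2. rewrite Ew2. apply in_or_app. right. now right. }
    assert (Hlen : length w3 < length w).
    { rewrite Ew, Ew2, !length_app. simpl. rewrite ?length_app. simpl. lia. }
    (* Returning to the side just reached: [w3] would be a shorter path of the forbidden kind, or it
       is empty and [w] contains the letter [y] twice in succession. *)
    assert (Hsame : t = u' \/ t = ee y u' -> False).
    { intros Hor. destruct w3 as [|s w3].
      - rewrite Ew, Ew2, <- app_assoc in Hr. simpl in Hr. apply red_app_r in Hr.
        destruct Hr as [Hr _]. now apply Hr.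
      - destruct (IH (s :: w3) Hlen u') as [G1 G2]; auto; try discriminate.
        + rewrite Ew, Ew2 in Hr. apply red_app_l in Hr. apply red_app_r in Hr. apply Hr.
        + lia.
        + intros a b E. replace (run dot b u') with (run dot (b ++ y :: w1) p)
            by (rewrite run_app; reflexivity).
          apply (Hlev (w4 ++ y :: a)). rewrite Ew, Ew2, E, <- !app_assoc. simpl. now rewrite <- app_assoc.
        + destruct Hor as [E|E]; [exact (G1 E)|]. apply (G2 y n Hy); [|exact E].
          exists u. now apply swapped_sym. }
    assert (Hjoin : lev u' = n \/ lev t = n -> t = run ee w3 u').
    { intros Hor. apply (uses_none_level w3 u' n); auto. }
    (* Returning from the opposite side: one end then lies on level [n], so [w3] is a path in the
       unmodified graph joining the two sides. *)
    assert (Hside : forall a b, (a = lower y n \/ a = ee y (lower y n)) ->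
              (b = upper y n \/ b = ee y (upper y n)) -> b = run ee w3 a \/ a = run ee w3 b -> False).
    { intros a b Ha Hb. apply (swapped_not_joined l k N0 y n a b w3 Hsep); auto. lia. }
    assert (Hside' : (u' = lower y n \/ u' = ee y (lower y n)) \/ (u' = upper y n \/ u' = ee y (upper y n))).
    { destruct Hsw as [_ Hsw]. tauto. }
    assert (Tside : (t = lower y n \/ t = ee y (lower y n)) \/ (t = upper y n \/ t = ee y (upper y n))).
    { destruct Htt as [t' [_ Htt]]. tauto. }
    assert (Llow : forall a, a = lower y n \/ a = ee y (lower y n) -> lev a = n).
    { intros a [->| ->]; rewrite ?ee_level; exact Lm. }
    destruct Hside' as [Hs|Hs], Tside as [Ht|Ht].
    + apply Hsame. destruct Hs as [->| ->], Ht as [->| ->]; rewrite ?ee_ee; auto.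
    + apply (Hside u' t Hs Ht). left. apply Hjoin. left. now apply Llow.
    + apply (Hside t u' Ht Hs). right. apply Hjoin. right. now apply Llow.
    + apply Hsame. destruct Hs as [->| ->], Ht as [->| ->]; rewrite ?ee_ee; auto.
  - assert (U2 : forall i, uses w2 u' i -> n < i).
    { intros i Hi. assert (n <= i) by (apply (Hsuf [] w2); auto).
      assert (i <> n) by (intros ->; auto). lia. }
    assert (Hboth : lev u = n \/ lev u' = n -> u = run ee w1 p /\ q = run ee w2 u').
    { rewrite Q2 in Lq |- *. intros [Hu|Hu'].
      - destruct (uses_none_level w1 p n) as (A & _ & B); auto.
        destruct (uses_none_level w2 u' n) as (_ & _ & D); auto. right. lia.
      - destruct (uses_none_level w2 u' n) as (_ & A & D); auto.
        destruct (uses_none_level w1 p n) as (_ & _ & B); auto. left. lia. }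
    (* With a single crossing the detour goes back along [w1] to [p], along [ys] to [q], and back
       along [w2] to [u']. The letter of the crossing itself is left out, which compensates for [ys]
       in the length bound. *)
    assert (Hjoin : lev u = n \/ lev u' = n -> u' = run ee (rev w2 ++ ys ++ rev w1) u).
    { intros Hor. destruct (Hboth Hor) as [B D]. rewrite B, !run_app.
      assert (Hinv : forall w v, run ee (rev w) (run ee w v) = v).
      { intros w' v. apply (run_rev ee (fun _ => True)); [intros; apply ee_ee | now apply Forall_forall]. }
      now rewrite Hinv, <- Eq, D, Hinv. }
    assert (Iz : incl (rev w2 ++ ys ++ rev w1) l).
    { apply incl_app; [|apply incl_app; [exact Hys|]]; intros t Ht; apply in_rev in Ht; auto. }
    assert (Lz : length (rev w2 ++ ys ++ rev w1) <= k).
    { rewrite !length_app, !length_rev. rewrite Ew, length_app in Hk. simpl in Hk. lia. }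
    assert (Llow : forall a, a = lower y n \/ a = ee y (lower y n) -> lev a = n).
    { intros a [->| ->]; rewrite ?ee_level; exact Lm. }
    assert (Hopp : ((u = lower y n \/ u = ee y (lower y n)) /\ (u' = upper y n \/ u' = ee y (upper y n))) \/
                   ((u' = lower y n \/ u' = ee y (lower y n)) /\ (u = upper y n \/ u = ee y (upper y n)))).
    { destruct Hsw as [_ Hsw]. tauto. }
    destruct Hopp as [[H1 H2]|[H1 H2]].
    + apply (swapped_not_joined l k N0 y n u u' _ Hsep Hy HN0 Hc H1 H2 Iz Lz).
      left. apply Hjoin. left. now apply Llow.
    + apply (swapped_not_joined l k N0 y n u' u _ Hsep Hy HN0 Hc H1 H2 Iz Lz).
      right. apply Hjoin. right. now apply Llow.
Qed.

Lemma run_dot_rev (w : list baire) (v : nat) : Forall bits w -> run dot (rev w) (run dot w v) = v.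
Proof. apply (run_rev dot bits). intros; now apply dot_dot. Qed.

(** By [no_short_cycle], the path of a fixed point must visit a level below some [N]. The fixed
    point is then the image of one of finitely many points under the inverse of one of finitely many
    suffixes of [w]. *)
Lemma finitely_many_fixed (w : list baire) :
  Forall bits w -> red w -> w <> [] -> finitely_many_fixed_points (run dot w).
Proof.
  intros Hb Hr Hne. destruct (separated_exists w (length w) Hb) as [N0 Hsep].
  (* [N] lies above every level reached by modifications made for levels below [N0], so exceptional
     edges met from there on are made for levels at least [N0]. *)
  assert (HN : exists N, N0 <= N /\ forall x n, In x w -> n < N0 -> lev (upper x n) < N).
  { destruct (finite_bound w (fun x N => forall n, n < N0 -> lev (upper x n) < N)) as [N HN].
    - intros x _. destruct (bounded_below (fun n => lev (upper x n)) N0) as [B HB].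
      exists B. intros N HN n Hn. specialize (HB n Hn). simpl in HB. lia.
    - exists (N0 + N). split; [lia|]. intros x n Hx Hn. apply HN; auto. lia. }
  destruct HN as (N & HN & Hup).
  assert (HB : exists B, forall i u, i <= length w -> u < start N -> run dot (rev (skipn i w)) u < B).
  { assert (H : exists f, forall i u, u < start N -> run dot (rev (skipn i w)) u < f i).
    { exists (fun i => proj1_sig (constructive_indefinite_description _
                (bounded_below (run dot (rev (skipn i w))) (start N)))).
      intros i. apply proj2_sig. }
    destruct H as [f Hf]. destruct (bounded_below f (S (length w))) as [B HB].
    exists B. intros i u Hi Hu. specialize (Hf i u Hu). specialize (HB i). lia. }
  destruct HB as [B HB]. exists B. intros v Hv.
  assert (Hlow : exists w1 w2, w = w1 ++ w2 /\ lev (run dot w2 v) < N).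
  { apply NNPP. intros Hno.
    destruct (no_short_cycle w (length w) N0 N Hb Hsep HN) with (w := w) (p := v) as [H _];
      auto using incl_refl.
    - intros x n u Hx [y Hy] Hu. destruct (swapped_level _ _ _ _ Hy) as (_ & H1 & H2).
      destruct (le_lt_dec N0 n) as [|Hn]; [assumption|]. specialize (Hup x n Hx Hn). lia.
    - intros w1 w2 E. destruct (le_lt_dec N (lev (run dot w2 v))); [assumption|].
      exfalso. apply Hno. eauto. }
  destruct Hlow as (w1 & w2 & E & Hl).
  assert (Hu : run dot w2 v < start N).
  { destruct (le_lt_dec (start N) (run dot w2 v)) as [H|]; [|assumption].
    apply lev_ge_iff in H. lia. }
  assert (Ev : v = run dot (rev (skipn (length w1) w)) (run dot w2 v)).
  { rewrite E, skipn_app, skipn_all, Nat.sub_diag. simpl. symmetry. apply run_dot_rev.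
    rewrite E in Hb. apply Forall_app in Hb. apply Hb. }
  rewrite Ev. apply HB; [|exact Hu]. rewrite E, length_app. lia.
Qed.

Definition mcg (f : baire) : Prop := exists l, Forall bits l /\ forall v, f v = run dot l v.

Lemma mcg_cofinitary : cofinitary mcg.
Proof.
  split; [split; [|split; [|split]]|].
  - intros f (l & Hl & Hf). split.
    + intros u v E. rewrite !Hf in E. apply (run_inj dot bits) in E; auto. intros; now apply dot_dot.
    + intros v. exists (run dot (rev l) v). rewrite Hf.
      rewrite <- (rev_involutive l) at 1. apply run_dot_rev. now apply Forall_rev.
  - exists []. auto.
  - intros f g (l & Hl & Hf) (k & Hk & Hg). exists (l ++ k). split; [now apply Forall_app|].
    intros v. now rewrite run_app, Hf, Hg.
  - intros f g (l & Hl & Hf) [_ Hfg]. exists (rev l). split; [now apply Forall_rev|].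
    intros v. rewrite <- (Hfg v) at 2. rewrite Hf. symmetry. now apply run_dot_rev.
  - intros f (l & Hl & Hf) [v0 Hv0].
    destruct (reduce dot bits l) as (k & H1 & H2 & _ & H4); [intros; now apply dot_dot | exact Hl|].
    assert (Hk : Forall bits k).
    { apply Forall_forall. rewrite Forall_forall in Hl. auto. }
    destruct k as [|y k].
    + exfalso. apply Hv0. rewrite Hf, <- H4. reflexivity.
    + destruct (finitely_many_fixed (y :: k)) as [B HB]; auto; [discriminate|].
      exists B. intros v Hv. apply HB. now rewrite H4, <- Hf.
Qed.

(** * Every permutation agrees infinitely often with an element of the group *)

Lemma pigeonhole {X : Type} (P : nat) (f : nat -> X) (L : list X) : forall pts : list nat,
  NoDup pts -> (forall v, In v pts -> In (f v) L) -> length L * P < length pts ->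
  exists a sub, In a L /\ NoDup sub /\ incl sub pts /\ P < length sub /\ forall v, In v sub -> f v = a.
Proof.
  induction L as [|a L IH]; simpl; intros pts Hnd Hin Hlen.
  - destruct pts as [|v pts]; simpl in Hlen; [lia|]. destruct (Hin v). now left.
  - set (t := fun v => if excluded_middle_informative (f v = a) then true else false).
    assert (Ht : forall v, t v = true <-> f v = a).
    { intros v. unfold t. destruct (excluded_middle_informative (f v = a)); easy. }
    destruct (le_lt_dec (length (filter t pts)) P) as [Hle|Hlt].
    + pose proof (filter_length t pts) as Hsum.
      destruct (IH (filter (fun v => negb (t v)) pts)) as (b & sub & H1 & H2 & H3 & H4 & H5).
      * now apply NoDup_filter.
      * intros v Hv. apply filter_In in Hv. destruct Hv as [Hv Hv'].
        destruct (Hin v Hv) as [E|]; [|assumption].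
        symmetry in E. apply Ht in E. rewrite E in Hv'. discriminate.
      * lia.
      * exists b, sub. repeat split; auto. intros v Hv. apply H3 in Hv. now apply filter_In in Hv.
    + exists a, (filter t pts). repeat split; auto.
      * now apply NoDup_filter.
      * intros v Hv. now apply filter_In in Hv.
      * intros v Hv. apply filter_In in Hv. now apply Ht.
Qed.

(** Injectivity sends at most [start n] points of the level below it. If none of the others is far,
    each is joined to its image by a code word, and the size of the level forces one word to serve
    more than [n] points. *)
Lemma far_or_popular (h : baire) (n : nat) :
  (forall u v, h u = h v -> u = v) -> (exists m, far h n m) \/ has_popular h n.
Proof.
  intros Hinj. destruct (classic (exists m, far h n m)) as [|Hno]; [now left|]. right.
  split; [intros m Hm; eauto|].
  set (I := seq (start n) (start (S n) - start n)).
  assert (HI : forall v, In v I <-> lev v = n).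
  { intros v. unfold I. rewrite in_seq, lev_iff. pose proof (start_req n). lia. }
  set (t := fun v => start n <=? h v). set (pts := filter t I).
  assert (Hpts : length I <= length pts + start n).
  { pose proof (filter_length t I) as E. fold pts in E.
    assert (length (filter (fun v => negb (t v)) I) <= start n); [|lia].
    rewrite <- (length_map h), <- (length_seq (start n) 0). apply NoDup_incl_length.
    - apply Injective_map_NoDup; [exact Hinj|]. apply NoDup_filter, seq_NoDup.
    - intros y Hy. apply in_map_iff in Hy. destruct Hy as (v & <- & Hv).
      apply filter_In in Hv. destruct Hv as [_ Hv]. unfold t in Hv.
      apply Bool.negb_true_iff, Nat.leb_gt in Hv. apply in_seq. lia. }
  set (good := fun v p => code_word n p /\ run gam (dl p) v = h v).
  set (f := fun v => dl (mu (good v))).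
  assert (Hf : forall v, In v pts -> good v (mu (good v))).
  { intros v Hv. apply filter_In in Hv. destruct Hv as [Hv Hv'].
    apply Nat.leb_le in Hv'. apply HI in Hv.
    assert (E : exists p, good v p).
    { apply NNPP. intros Hn. apply Hno. exists v. repeat split; auto.
      intros p Hp E. apply Hn. now exists p. }
    destruct E as [p Hp]. exact (mu_in _ p Hp). }
  destruct (pigeonhole n f (words (letters n) n) pts) as (w & sub & H1 & H2 & H3 & H4 & H5).
  - apply NoDup_filter, seq_NoDup.
  - intros v Hv. destruct (Hf v Hv) as [Hc _]. apply in_words.
    split; [apply Hc | now apply code_word_letters].
  - rewrite word_count_spec. pose proof (start_req n) as R. unfold req in R.
    unfold I in Hpts. rewrite length_seq in Hpts. lia.
  - destruct sub as [|v0 sub'] eqn:Esub; [simpl in H4; lia|]. rewrite <- Esub in *.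
    assert (Hv0 : In v0 sub) by (rewrite Esub; now left).
    exists (mu (good v0)). split; [now apply Hf, H3|].
    change (dl (mu (good v0))) with (f v0). rewrite (H5 v0 Hv0).
    intros z Hz. apply NNPP. intros Hn.
    assert (length sub <= length (dl z)); [|lia]. apply NoDup_incl_length; [exact H2|].
    intros v Hv. apply NNPP. intros Hv'. apply Hn. exists v. split; [|split; [|exact Hv']].
    + specialize (H3 v Hv). apply filter_In in H3. now apply HI.
    + rewrite <- (H5 v Hv). now apply Hf, H3.
Qed.

(** The modifications of one generator occupy disjoint ranges of levels, so at most one of them
    meets a given level, and it has four end points. *)
Lemma touched_level_bound (x : baire) (n : nat) :
  exists T, length T <= 4 /\ forall i v, lev v = n -> touched x i v -> In v T.
Proof.
  destruct (classic (exists i v, lev v = n /\ touched x i v)) as [(i & v & Hv & Hi)|Hno].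
  - exists [lower x i; upper x i; ee x (lower x i); ee x (upper x i)]. split; [simpl; lia|].
    intros j u Hu Hj. destruct Hi as [y Hi], Hj as [z Hj].
    destruct (swapped_level _ _ _ _ Hi) as (C1 & L1 & M1).
    destruct (swapped_level _ _ _ _ Hj) as (C2 & L2 & M2).
    destruct (cut_level x i C1) as [_ L3]. destruct (cut_level x j C2) as [_ L4].
    assert (j = i) as ->.
    { destruct (lt_eq_lt_dec i j) as [[Hl|He]|Hl]; [|now symmetry|].
      - pose proof (cut_separated x i j C1 C2 Hl). lia.
      - pose proof (cut_separated x j i C2 C1 Hl). lia. }
    destruct Hj as [_ Hj]. simpl. intuition auto.
  - exists []. split; [simpl; lia|]. intros i v Hv Hi. exfalso. eauto.
Qed.

(** Each letter contributes at most four exceptional points, pulled back along the part of the word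
    already read. *)
Lemma run_dot_exceptions (w : list baire) (n : nat) :
  exists Z, length Z <= 4 * length w /\
    forall v, lev v = n -> ~ In v Z -> run dot w v = run ee w v.
Proof.
  induction w as [|y w (Z & HZ & IH)]; simpl; [exists []; auto|].
  destruct (touched_level_bound y n) as (T & HT & HT').
  exists (Z ++ map (run ee (rev w)) T). rewrite length_app, length_map. split; [lia|].
  intros v Hv Hn. fold (run dot w v) (run ee w v). rewrite IH; auto.
  2:{ intros Hi. apply Hn. apply in_or_app. now left. }
  apply dot_untouched. intros i Hi. apply Hn. apply in_or_app. right. apply in_map_iff.
  exists (run ee w v). split.
  - apply (run_rev ee (fun _ => True)); [intros; apply ee_ee | now apply Forall_forall].
  - apply (HT' i); [|exact Hi]. now rewrite (proj2 (run_ee w v)).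
Qed.

Definition graph_real (h : baire) (c : nat) : nat := if Nat.eq_dec (h (cfst c)) (csnd c) then 1 else 0.

Lemma graph_real_bits (h : baire) : bits (graph_real h).
Proof. intros c. unfold graph_real. destruct (Nat.eq_dec _ _); lia. Qed.

Lemma decoded_graph_real (h : baire) : decoded (graph_real h) = h.
Proof.
  apply functional_extensionality. intros i. unfold decoded, graph_real. apply mu_eq.
  - rewrite cfst_pair, csnd_pair. now destruct (Nat.eq_dec (h i) (h i)).
  - intros j. rewrite cfst_pair, csnd_pair. destruct (Nat.eq_dec (h i) j); [auto | discriminate].
Qed.

Lemma cand_infinite (h : baire) (N : nat) : (forall u v, h u = h v -> u = v) ->
  exists n, N <= n /\ cand (graph_real h) n.
Proof.
  intros Hinj. set (x := graph_real h). exists (cpair N (bcode x N)).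
  split; [unfold cpair; nia|]. split; [now exists N|]. unfold x at 1. rewrite decoded_graph_real.
  set (n := cpair _ _). destruct (far_or_popular h n Hinj) as [[m Hm]|Hp].
  - exists m. now left.
  - destruct (popular_word_spec h n Hp) as [_ H]. destruct (dl_surj []) as [z Hz].
    destruct (H z) as (v & H1 & H2 & _); [rewrite Hz; simpl; lia|]. exists v. right. auto.
Qed.

(** The greedy selection never stops: without further cuts [used] would be constant, and an
    infertile candidate far enough beyond that constant would be selected. *)
Lemma cut_infinite (x : baire) : bits x ->
  (forall N, exists n, N <= n /\ cand x n /\ ~ fertile x n) -> forall N, exists n, N <= n /\ cut x n.
Proof.
  intros Hx Hinf N.
  destruct (barren_not_joined x [] (Forall_nil _) I) as [N1 HN1].
  destruct (barren_not_joined x [x]) as [N2 HN2]; [auto | now split|].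
  apply NNPP. intros Hno.
  assert (Hused : forall n, N <= n -> used x n = used x N).
  { induction 1 as [|n Hn IH]; [reflexivity|]. rewrite <- IH. unfold used at 1. simpl.
    apply ite_false. intros Hc. apply Hno. exists n. split; [exact Hn | exact Hc]. }
  destruct (Hinf (N + N1 + N2 + used x N)) as (n & Hn & Hc & Hf).
  apply Hno. exists n. split; [lia|]. split.
  - split; [exact Hc|]. split; [exact Hf|].
    specialize (HN1 n ltac:(lia) Hc Hf). specialize (HN2 n ltac:(lia) Hc Hf). simpl in *. auto.
  - rewrite Hused by lia. lia.
Qed.

(** All popular words along the chain have the same length, and in each position the binary words
    extend one another; their unions are the required sequences. *)
Lemma coherent_chain (h : baire) (F : nat -> nat) :
  (forall t, coherent h (F t) (F (S t))) ->
  exists w, Forall bits w /\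
    forall t, dl (popular_word h (F t)) = map (fun x => bcode x (F t)) w.
Proof.
  intros HF.
  set (J := csnd (popular_word h (F 0))). set (s := fun t i => el (popular_word h (F t)) i).
  assert (HJ : forall t, csnd (popular_word h (F t)) = J).
  { induction t as [|t IH]; [reflexivity|]. destruct (HF t) as (_ & _ & _ & E & _). congruence. }
  assert (Hpre : forall t i, i < J -> prefix_letter (F t) (s t i) (F (S t)) (s (S t) i)).
  { intros t i Hi. destruct (HF t) as (_ & _ & _ & _ & H). apply H. now rewrite HJ. }
  assert (Hlt : forall t, F t < F (S t)) by (intros t; apply HF).
  assert (Hge : forall t, t <= F t).
  { induction t as [|t IH]; [lia|]. specialize (Hlt t). lia. }
  set (code := fun t i V => (forall k, k < F t -> beta V k < 2) /\ bcode (beta V) (F t) = s t i).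
  set (V := fun t i => mu (code t i)).
  assert (HV : forall t i, i < J -> code t i (V t i)).
  { intros t i Hi. destruct (Hpre t i Hi) as (U & H1 & H2 & _).
    apply (mu_in (code t i) U). split; [|exact H2]. intros k Hk. apply H1. specialize (Hlt t). lia. }
  assert (Hstep : forall t i k, i < J -> k < F t -> beta (V (S t) i) k = beta (V t i) k).
  { intros t i k Hi Hk. destruct (Hpre t i Hi) as (U & H1 & H2 & H3).
    destruct (HV t i Hi) as [A1 A2]. destruct (HV (S t) i Hi) as [B1 B2]. specialize (Hlt t).
    transitivity (beta U k).
    - apply (bcode_inj _ _ (F (S t))); auto; [congruence | lia].
    - apply (bcode_inj _ _ (F t)); auto; [|congruence]. intros; apply H1; lia. }
  assert (Hconst : forall t t' i k, t <= t' -> i < J -> k < F t -> beta (V t' i) k = beta (V t i) k).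
  { intros t t' i k Ht Hi Hk. induction Ht as [|t' Ht IH]; [reflexivity|].
    rewrite Hstep; auto. clear -Ht Hk Hlt. induction Ht as [|t' Ht IH]; [exact Hk|].
    specialize (Hlt t'). lia. }
  (* Stage [S k] already determines bit [k], because [k < S k <= F (S k)]. *)
  set (g := fun i k => beta (V (S k) i) k).
  assert (Hg : forall i t k, i < J -> k < F t -> g i k = beta (V t i) k).
  { intros i t k Hi Hk. unfold g. assert (k < F (S k)) by (pose proof (Hge (S k)); lia).
    destruct (le_lt_dec t (S k)) as [Hl|Hl]; [|symmetry]; apply Hconst; auto; lia. }
  exists (mk g J). split.
  - apply Forall_mk. intros i Hi k. assert (Hk : k < F (S k)) by (pose proof (Hge (S k)); lia).
    now apply (HV (S k) i Hi).
  - intros t. unfold dl. rewrite HJ, map_mk. apply mk_ext. intros i Hi.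
    destruct (HV t i Hi) as [_ E]. fold (s t i). rewrite <- E. apply bcode_ext.
    intros k Hk. symmetry. now apply Hg.
Qed.

Lemma infinite_agreement (h : baire) : (forall u v, h u = h v -> u = v) ->
  exists l, Forall bits l /\ forall N, exists v, N <= v /\ run dot l v = h v.
Proof.
  intros Hinj. set (x := graph_real h). assert (Hx := graph_real_bits h). fold x in Hx.
  assert (Hdec : decoded x = h) by apply decoded_graph_real.
  destruct (classic (forall N, exists n, N <= n /\ cand x n /\ ~ fertile x n)) as [Hinf|Hfin].
  - exists [x]. split; [auto|]. intros N.
    destruct (cut_infinite x Hx Hinf N) as (n & Hn & Hc). exists (lower x n). split.
    + destruct (cut_level x n Hc) as [L _]. apply lev_iff in L. pose proof (start_ge n). lia.
    + simpl. rewrite (dot_swapped x n (lower x n) (upper x n)); auto.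
      * unfold upper. now rewrite Hdec.
      * split; auto.
  - apply not_all_ex_not in Hfin. destruct Hfin as [N1 HN1].
    set (P := fun n => N1 <= n /\ cand x n).
    set (nxt := fun n => mu (fun n' => P n' /\ coherent h n n')).
    assert (Hnxt : forall n, P n -> P (nxt n) /\ coherent h n (nxt n)).
    { intros n [Hn Hc]. assert (Hf : fertile x n).
      { apply NNPP. intros Hf. apply HN1. eauto. }
      destruct (Hf N1) as (n' & H1 & H2 & H3). rewrite Hdec in H3.
      apply (mu_in (fun n' => P n' /\ coherent h n n') n').
      split; [split; [lia | exact H2] | exact H3]. }
    destruct (cand_infinite h N1 Hinj) as (n0 & Hn0 & Hc0).
    set (F := fun t => Nat.iter t nxt n0).
    assert (HP : forall t, P (F t)).
    { induction t as [|t IH]; [now split|]. apply (Hnxt (F t) IH). }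
    assert (HF : forall t, coherent h (F t) (F (S t))) by (intros t; apply (Hnxt (F t) (HP t))).
    destruct (coherent_chain h F HF) as (w & Hw & Ew). exists w. split; [exact Hw|].
    (* The summand [N] pushes the agreement beyond [N]; the other makes the level large enough for
       popularity to avoid all points where [dot] and [ee] differ along [w]. *)
    intros N. set (t := N + 4 * length w). set (n := F t).
    assert (Hge : forall t, t <= F t).
    { induction t0 as [|t0 IH]; [lia|]. destruct (HF t0) as [Hl _]. lia. }
    assert (Hn : t <= n) by apply Hge.
    destruct (run_dot_exceptions w n) as (Z & HZ & HZ'). destruct (dl_surj Z) as [z Hz].
    assert (Hpop : has_popular h n) by apply (HF t).
    destruct (popular_word_spec h n Hpop) as [_ H].
    destruct (H z) as (v & H1 & H2 & H3); [rewrite Hz; unfold t in Hn; lia|].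
    exists v. split.
    + apply lev_iff in H1. pose proof (start_ge n). unfold t in Hn. lia.
    + rewrite HZ' by (rewrite <- ?Hz; assumption).
      rewrite (proj1 (run_ee w v)), H1. unfold n at 1. rewrite <- Ew. exact H2.
Qed.

Lemma mcg_maximal : maximal_cofinitary mcg.
Proof.
  split; [exact mcg_cofinitary|].
  intros H [[Hbij [_ [Hcomp _]]] Hfix] Hsub h Hh.
  destruct (Hbij h Hh) as [Hinj _].
  destruct (infinite_agreement h Hinj) as (l & Hl & Hagree).
  assert (Hq : H (fun v => run dot (rev l) (h v))).
  { apply (Hcomp (run dot (rev l)) h); [|exact Hh]. apply Hsub. exists (rev l).
    split; [now apply Forall_rev | reflexivity]. }
  exists l. split; [exact Hl|]. intros v. apply NNPP. intros Hne.
  destruct (Hfix _ Hq) as [N HN].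
  - exists v. intros E. apply Hne. rewrite <- E at 2. rewrite <- (rev_involutive l) at 1.
    symmetry. apply run_dot_rev. now apply Forall_rev.
  - destruct (Hagree N) as (u & Hu & E). specialize (HN u).
    rewrite <- E, run_dot_rev in HN by exact Hl. specialize (HN eq_refl). lia.
Qed.

(** * The group is arithmetical *)

Definition word_at (f : baire) (k n p : nat) : Prop :=
  csnd p = k /\ red (dl p) /\ Forall (fun s => prefix_letter n s n s) (dl p) /\
  exists z, length (dl z) <= n /\ forall v, lev v = n -> In v (dl z) \/ f v = run gam (dl p) v.

(* Bit [a] of the [i]-th generator (counted from the right) of an element [f] of the group that is a
   reduced word of length [k]. *)
Definition factor (f : baire) (k i a : nat) : nat :=
  ite (exists N, forall n, N <= n -> exists p, word_at f k n p /\
         exists V, (forall t, t < n -> beta V t < 2) /\ bcode (beta V) n = el p i /\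
                   beta V a = 1 /\ a < n) 1 0.

Lemma dp_word_at : forall H A B C, dfun H -> df A -> df B -> df C ->
  dp (fun x e => word_at (H x e) (A x e) (B x e) (C x e)).
Proof. apply dp_rel3. unfold word_at. dsolve. Qed.
#[export] Hint Resolve dp_word_at : arith_def.

Lemma df_factor : forall H A B C, dfun H -> df A -> df B -> df C ->
  df (fun x e => factor (H x e) (A x e) (B x e) (C x e)).
Proof. apply df_fun3. unfold factor. dsolve. Qed.
#[export] Hint Resolve df_factor : arith_def.

Lemma level_outside (n : nat) (Z : list nat) :
  length Z <= 2 * n -> exists v, lev v = n /\ ~ In v Z.
Proof.
  intros HZ. apply NNPP. intros Hno. pose proof (start_req n) as R. unfold req in R.
  assert (H : length (seq (start n) (start (S n) - start n)) <= length Z).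
  { apply NoDup_incl_length; [apply seq_NoDup|]. intros v Hv. apply in_seq in Hv.
    apply NNPP. intros Hv'. apply Hno. exists v. split; [apply lev_iff; lia | exact Hv']. }
  rewrite length_seq in H. lia.
Qed.

(** A competing word and the codes of [l] agree with [f] off two sets of size at most [n]. The level
    has a point outside both, and there [gam_unique] identifies the words. *)
Lemma word_at_run (l : list baire) (f : baire) :
  Forall bits l -> red l -> (forall v, f v = run dot l v) ->
  exists N, forall n, N <= n ->
    (exists p, word_at f (length l) n p) /\
    forall p, word_at f (length l) n p -> dl p = map (fun x => bcode x n) l.
Proof.
  intros Hl Hr Hf. destruct (letters_distinct l Hl) as [N HN].
  exists (N + 4 * length l). intros n Hn.
  assert (Hred : red (map (fun x => bcode x n) l)).
  { apply red_map; [|exact Hr]. intros a b Ha Hb. apply HN; auto; lia. }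
  destruct (run_dot_exceptions l n) as (Z & HZ & HZ').
  assert (E : forall v, lev v = n -> ~ In v Z -> f v = run gam (map (fun x => bcode x n) l) v).
  { intros v Hv Hz. now rewrite Hf, HZ', (proj1 (run_ee l v)), Hv. }
  split.
  - destruct (dl_surj (map (fun x => bcode x n) l)) as [p Hp]. destruct (dl_surj Z) as [z Hz].
    exists p. unfold word_at. rewrite <- length_dl, Hp, length_map. repeat split; auto.
    + apply Forall_map. eapply Forall_impl; [|exact Hl]. intros a Ha. now apply prefix_letter_bcode.
    + exists z. rewrite Hz. split; [lia|]. intros v Hv. destruct (classic (In v Z)); auto.
  - intros p (H1 & H2 & H3 & z & Hz & H4).
    destruct (level_outside n (Z ++ dl z)) as (v & Hv & Hv'); [rewrite length_app; lia|].
    rewrite in_app_iff in Hv'.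
    apply (gam_unique n _ _ v); auto.
    + eapply Forall_impl; [|exact H3]. intros s. apply prefix_letter_lt.
    + now apply bcode_letters.
    + rewrite length_dl, length_map. lia.
    + rewrite <- E by tauto. destruct (H4 v Hv); [tauto | now symmetry].
Qed.

Lemma factor_spec (g : nat -> baire) (k : nat) (f : baire) :
  Forall bits (mk g k) -> red (mk g k) -> (forall v, f v = run dot (mk g k) v) ->
  forall i, i < k -> factor f k i = g i.
Proof.
  intros Hb Hr Hf i Hi. destruct (word_at_run _ f Hb Hr Hf) as [N HN]. rewrite length_mk in HN.
  assert (Hel : forall n p, N <= n -> word_at f k n p -> el p i = bcode (g i) n).
  { intros n p Hn Hp. apply (proj2 (HN n Hn)) in Hp as E. rewrite map_mk in E.
    destruct Hp as [Hk _]. unfold dl in E. rewrite Hk in E. exact (mk_inj _ _ _ i E Hi). }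
  rewrite Forall_mk in Hb. specialize (Hb i Hi).
  apply functional_extensionality. intros a. unfold factor.
  destruct (Nat.eq_dec (g i a) 1) as [E|E].
  - rewrite ite_true; [now symmetry|]. exists (N + S a). intros n Hn.
    destruct (HN n ltac:(lia)) as [[p Hp] _]. exists p. split; [exact Hp|].
    destruct (beta_spec (g i) n) as [V HV]. exists V. repeat split; try lia.
    + intros t Ht. now rewrite HV.
    + rewrite (Hel n p ltac:(lia) Hp). now apply bcode_ext.
    + rewrite HV by lia. exact E.
  - rewrite ite_false; [specialize (Hb a); lia|]. intros [M HM]. apply E.
    destruct (HM (M + N) ltac:(lia)) as (p & Hp & V & H1 & H2 & H3 & H4).
    rewrite (Hel (M + N) p ltac:(lia) Hp) in H2. rewrite <- H3. symmetry.
    now apply (bcode_inj _ _ (M + N)).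
Qed.

(** The right side quantifies over numbers only. It implies membership without further conditions on
    [k], because [factor] takes only the values 0 and 1 and so always yields an index of a
    generator. *)
Lemma mcg_iff (f : baire) :
  mcg f <-> exists k, forall v, f v = prec v (fun i u => dot (factor f k i) u) k.
Proof.
  split.
  - intros (l0 & Hl0 & Hf0).
    destruct (reduce dot bits l0) as (l & H1 & H2 & _ & H4); [intros; now apply dot_dot | exact Hl0|].
    assert (Hl : Forall bits l).
    { apply Forall_forall. rewrite Forall_forall in Hl0. auto. }
    destruct (@mk_surj baire (fun _ => 0) l) as [g Hg]. exists (length l). intros v.
    rewrite <- (run_mk dot), Hf0, <- H4. f_equal. rewrite Hg at 1. apply mk_ext. intros i Hi.
    symmetry. apply (factor_spec g (length l) f); [now rewrite <- Hg | now rewrite <- Hg | | exact Hi].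
    intros u. now rewrite Hf0, <- H4, <- Hg.
  - intros [k Hk]. exists (mk (factor f k) k). split.
    + apply Forall_mk. intros i _ a. unfold factor, ite. destruct (excluded_middle_informative _); lia.
    + intros v. now rewrite run_mk.
Qed.

Theorem theorem2p2 :
  exists G : baire -> Prop, maximal_cofinitary G /\ arithmetical G.
Proof.
  exists mcg. split; [exact mcg_maximal|]. apply dp_arithmetical.
  apply (dp_iff (fun f e => exists k, forall v, f v = prec v (fun i u => dot (factor f k i) u) k)).
  - intros f e. apply mcg_iff.
  - dsolve.
Qed.
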